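(* Let $k$ be a perfect field and let $X$ be an integral algebraic variety over $k$. Let $f\colon \mathrm{Bl}_{\mathrm{Der}}(X)\to X$ be the blow-up of $X$ at the sheaf of derivations $\mathcal{D}er_k(\mathcal{O}_X)$. Assume that the Zariski–Lipman conjecture holds (for varieties over $k$). If $f$ is an isomorphism, then $X$ is nonsingular.
   Context: Sheaf of derivations: $\mathcal{D}er_k(\mathcal{O}_X)=\mathcal{H}om_{\mathcal{O}_X}(\Omega_{X/k},\mathcal{O}_X)$, the dual of the sheaf of Kähler differentials. Blow-up at a coherent module: let $X$ be integral and $M$ a coherent $\mathcal{O}_X$-module of (generic) rank $r$. The blow-up of $X$ at $M$ is the proper birational morphism $f\colon \mathrm{Bl}_M(X)\to X$ characterized by: (1) $f^*M/\mathrm{tor}$ (the quotient by torsion) is locally free of rank $r$; (2) for any morphism $\sigma\colon Z\to X$ such that $\sigma^*M/\mathrm{tor}$ is locally free of rank $r$ there is a unique $\beta\colon Z\to \mathrm{Bl}_M(X)$ with $f\circ\beta=\sigma$. Locally on $\mathrm{Spec}(R)$, with $R$ a domain with fraction field $K$, it is the blow-up of a fractional ideal representing the norm $\mathrm{Im}(\bigwedge^r M\to \bigwedge^r M\otimes_R K\cong K)$. One writes $\mathrm{Bl}_{\mathrm{Der}}(X)$ when $M$ is the sheaf of derivations of $X$. Zariski–Lipman conjecture (over $k$): if $Y$ is a variety over $k$ such that $\mathcal{D}er_k(\mathcal{O}_Y)$ is free, then $Y$ is smooth (equivalently, in local form: if $\mathrm{Der}_k(\mathcal{O}_{Y,p})$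 is a free $\mathcal{O}_{Y,p}$-module, then $\mathcal{O}_{Y,p}$ is regular). *)

(* Defs.v *)
From HB Require Import structures.
From mathcomp Require Import all_boot all_algebra generic_quotient.
From mathcomp Require Import boolp classical_sets topology.
Set Implicit Arguments.
Unset Strict Implicit.
Unset Printing Implicit Defensive.
Import GRing.Theory.
Local Open Scope classical_set_scope.
Local Open Scope ring_scope.
Local Open Scope quotient_scope.

(* Rings are [comPzRingType]s because the sections over the empty set form the
   zero ring. *)

Section Algebra.
Implicit Type A : comPzRingType.

Definition perfect_field (k : fieldType) : Prop :=
  forall p, p \in [pchar k] -> forall a : k, exists b : k, b ^+ p = a.

Definition invertible A (a : A) : Prop := exists b, a * b = 1.

Definition domain A : Prop :=
  (1 : A) <> 0 /\ forall a b : A, a * b = 0 -> a = 0 \/ b = 0.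

Definition ideal A (I : A -> Prop) : Prop :=
  [/\ I 0, forall a b, I a -> I b -> I (a + b) & forall a b, I b -> I (a * b)].

Definition prime_ideal A (P : A -> Prop) : Prop :=
  [/\ ideal P, ~ P 1 & forall a b, P (a * b) -> P a \/ P b].

Definition generates A n (g : 'I_n -> A) (I : A -> Prop) : Prop :=
  forall a, I a <-> exists c : 'I_n -> A, a = \sum_i c i * g i.

Definition noetherian A : Prop :=
  forall I : A -> Prop, ideal I -> exists n (g : 'I_n -> A), generates g I.

Definition nonunit A (a : A) : Prop := ~ invertible a.

Definition local_ring A : Prop := ideal (@nonunit A).

(* a chain P_0 < P_1 < ... < P_n of primes *)
Definition prime_chain A n (P : nat -> A -> Prop) : Prop :=
  (forall i, (i <= n)%N -> prime_ideal (P i)) /\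
  (forall i, (i < n)%N ->
     (forall a, P i a -> P i.+1 a) /\ exists a, P i.+1 a /\ ~ P i a).

Definition krull_dim A (n : nat) : Prop :=
  (exists P : nat -> A -> Prop, prime_chain n P) /\
  ~ (exists P : nat -> A -> Prop, prime_chain n.+1 P).

Definition regular_local_ring A : Prop :=
  [/\ local_ring A, noetherian A &
      exists2 d, krull_dim A d
        & exists g : 'I_d -> A, generates g (@nonunit A)].

Definition fg_algebra A (B : comPzRingType) (phi : A -> B) : Prop :=
  exists n (g : 'I_n -> B), forall S : B -> Prop,
    (forall a, S (phi a)) -> (forall i, S (g i)) ->
    (forall x y, S x -> S y -> S (x + y)) ->
    (forall x y, S x -> S y -> S (x * y)) -> forall b, S b.

(* phi identifies B with the localization A[1/s] *)
Definition localization_at A (B : comPzRingType) (phi : A -> B) (s : A) : Prop :=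
  [/\ invertible (phi s),
      forall a, phi a = 0 -> exists n, s ^+ n * a = 0 &
      forall b, exists n a, phi s ^+ n * b = phi a].

(* Der_k(A), for the k-algebra structure iota : k -> A *)
Definition derivation (k : fieldType) A (iota : k -> A) (D : A -> A) : Prop :=
  [/\ forall a b, D (a + b) = D a + D b,
      forall a b, D (a * b) = a * D b + b * D a &
      forall c, D (iota c) = 0].

(* Only finite ranks are considered: Der_k(A) is finitely generated in the
   intended case, a localization of a finitely generated k-algebra. *)
Definition der_free (k : fieldType) A (iota : k -> A) : Prop :=
  exists r (e : 'I_r -> A -> A), (forall i, derivation iota (e i)) /\
    forall D, derivation iota D ->
      exists! c : {ffun 'I_r -> A}, forall a, D a = \sum_i c i * e i a.

End Algebra.

Record opens (T : topologicalType) := Opens { oset :> set T; _ : open oset }.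
Definition omem (T : topologicalType) (U : opens T) : T -> Prop := oset U.
Coercion omem : opens >-> Funclass.

Section Opens.
Variable T : topologicalType.

Lemma opens_open (U : opens T) : open U. Proof. by case: U. Qed.

Definition oI (U V : opens T) : opens T :=
  @Opens T (U `&` V) (openI (opens_open U) (opens_open V)).

Definition oT : opens T := @Opens T setT openT.

End Opens.

Definition covers (T : topologicalType) (C : opens T -> Prop) (U : opens T) :=
  (forall V, C V -> V `<=` U) /\ (forall x, U x -> exists2 V, C V & V x).

(* A sheaf of k-algebras, i.e. a ringed space over Spec k. *)
Record kspace (k : fieldType) := KSpace {
  pt :> topologicalType;
  sec : opens pt -> comPzRingType;
  res : forall U V : opens pt, V `<=` U -> {rmorphism sec U -> sec V};
  scal : forall U : opens pt, {rmorphism k -> sec U};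
  res_id : forall (U : opens pt) (h : U `<=` U) s, res h s = s;
  res_res : forall (U V W : opens pt) (h : V `<=` U) (h' : W `<=` V)
    (h'' : W `<=` U) s,
    res h' (res h s) = res h'' s;
  res_scal : forall (U V : opens pt) (h : V `<=` U) c, res h (scal U c) = scal V c;
  sec_sep : forall U C, covers C U -> forall s t : sec U,
    (forall (V : opens pt) (h : V `<=` U), C V -> res h s = res h t) -> s = t;
  sec_glue : forall U C, covers C U -> forall s : (forall V, sec V),
    (forall (V V' W : opens pt) (h : W `<=` V) (h' : W `<=` V'), C V -> C V' ->
       res h (s V) = res h' (s V')) ->
    exists t : sec U, forall (V : opens pt) (h : V `<=` U), C V -> res h t = s V
}.
Arguments sec {k X} U : rename.
Arguments res {k X U V} h : rename.
Arguments scal {k X} U : rename.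

Section Stalk.
Variables (k : fieldType) (X : kspace k) (x : X).

Record pregerm := PreGerm { gdom : opens X; _ : gdom x; gsec : sec gdom }.

HB.instance Definition _ := gen_eqMixin pregerm.
HB.instance Definition _ := gen_choiceMixin pregerm.

Lemma gdomP (g : pregerm) : gdom g x. Proof. by case: g. Qed.

Definition same_germ (g g' : pregerm) : Prop :=
  exists (W : opens X) (h : W `<=` gdom g) (h' : W `<=` gdom g'),
    W x /\ res h (gsec g) = res h' (gsec g').

Definition same_germb : rel pregerm := fun g g' => `[< same_germ g g' >].

Lemma same_germ_refl : reflexive same_germb.
Proof.
move=> g; apply/asboolP; exists (gdom g), (@subset_refl _ _), (@subset_refl _ _).
by split=> //; exact: gdomP.
Qed.

Lemma same_germ_sym : symmetric same_germb.
Proof.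
suff H g g' : same_germ g g' -> same_germ g' g.
  by move=> g g'; apply: asbool_equiv_eq; split; exact: H.
by case=> [W [h [h' [Wx e]]]]; exists W, h', h.
Qed.

Lemma same_germ_trans : transitive same_germb.
Proof.
move=> g2 g1 g3 /asboolP[W [h1 [h2 [Wx e]]]] /asboolP[W' [h2' [h3 [W'x e']]]].
apply/asboolP; have s : oI W W' `<=` W by move=> y [].
have s' : oI W W' `<=` W' by move=> y [].
exists (oI W W'), (subset_trans s h1), (subset_trans s' h3); split=> //.
rewrite -(res_res h1 s) -(res_res h3 s') e -e'.
by rewrite (res_res _ _ (subset_trans s h2)) (res_res _ _ (subset_trans s h2)).
Qed.

Canonical germ_rel :=
  EquivRel same_germb same_germ_refl same_germ_sym same_germ_trans.

Definition stalk := {eq_quot germ_rel}.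
HB.instance Definition _ := Choice.on stalk.

Definition germ (U : opens X) (Ux : U x) (s : sec U) : stalk :=
  \pi_{eq_quot germ_rel} (PreGerm Ux s).

Lemma germP (U V : opens X) (Ux : U x) (Vx : V x) (s : sec U) (t : sec V) :
  germ Ux s = germ Vx t <->
  exists (W : opens X) (h : W `<=` U) (h' : W `<=` V), W x /\ res h s = res h' t.
Proof.
by split=> [/eqmodP /asboolP //|H]; apply/eqmodP/asboolP.
Qed.

Lemma germ_res (U V : opens X) (Ux : U x) (Vx : V x) (h : V `<=` U) (s : sec U) :
  germ Vx (res h s) = germ Ux s.
Proof.
by apply/germP; exists V, (@subset_refl _ _), h; split=> //; rewrite res_id.
Qed.

Lemma stalk_rep (a : stalk) : exists (U : opens X) (Ux : U x) (s : sec U),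
  a = germ Ux s.
Proof. by elim/quotW: a => -[U Ux s]; exists U, Ux, s. Qed.

Definition stalk_const (c : k) : stalk := @germ (oT X) I (scal _ c).

Definition stalk_opp (a : stalk) : stalk :=
  germ (gdomP (repr a)) (- gsec (repr a)).

Let lsub (U V : opens X) : oI U V `<=` U := @subIsetl _ U V.
Let rsub (U V : opens X) : oI U V `<=` V := @subIsetr _ U V.

Definition stalk_op (f : forall U : opens X, sec U -> sec U -> sec U)
    (a b : stalk) : stalk :=
  @germ (oI (gdom (repr a)) (gdom (repr b)))
    (conj (gdomP (repr a)) (gdomP (repr b)))
    (f _ (res (@lsub _ _) (gsec (repr a))) (res (@rsub _ _) (gsec (repr b)))).

Definition stalk_add := stalk_op (fun _ s t => s + t).
Definition stalk_mul := stalk_op (fun _ s t => s * t).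

Lemma repr_germ (U : opens X) (Ux : U x) (s : sec U) :
  exists (W : opens X) (h : W `<=` gdom (repr (germ Ux s))) (h' : W `<=` U),
    W x /\ res h (gsec (repr (germ Ux s))) = res h' s.
Proof.
have := reprK (germ Ux s); case: (repr _) => V Vx t /= e.
exact/(germP Vx Ux t s).
Qed.

Lemma stalk_opE f : (forall (U V : opens X) (h : V `<=` U) s t,
    res h (f U s t) = f V (res h s) (res h t)) ->
  forall (U : opens X) (Ux : U x) s t,
  stalk_op f (germ Ux s) (germ Ux t) = germ Ux (f U s t).
Proof.
move=> fres U Ux s t; rewrite /stalk_op.
have [W [h1 [h1' [Wx e1]]]] := repr_germ Ux s.
have [V [h2 [h2' [Vx e2]]]] := repr_germ Ux t.
apply/germP; have l : oI W V `<=` W by move=> y [].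
have r : oI W V `<=` V by move=> y [].
have H : oI W V `<=` oI (gdom (repr (germ Ux s))) (gdom (repr (germ Ux t))).
  by move=> y [/h1 ? /h2 ?].
exists (oI W V), H, (subset_trans l h1'); split=> //; rewrite !fres.
congr (f _ _ _).
  rewrite (res_res _ _ (subset_trans l h1)) -(res_res h1 l) e1.
  exact: res_res.
rewrite (res_res _ _ (subset_trans r h2)) -(res_res h2 r) e2.
exact: res_res.
Qed.

Lemma stalk_addE (U : opens X) (Ux : U x) s t :
  stalk_add (germ Ux s) (germ Ux t) = germ Ux (s + t).
Proof. by rewrite /stalk_add stalk_opE // => *; rewrite rmorphD. Qed.

Lemma stalk_mulE (U : opens X) (Ux : U x) s t :
  stalk_mul (germ Ux s) (germ Ux t) = germ Ux (s * t).
Proof. by rewrite /stalk_mul stalk_opE // => *; rewrite rmorphM. Qed.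

Lemma stalk_oppE (U : opens X) (Ux : U x) s :
  stalk_opp (germ Ux s) = germ Ux (- s).
Proof.
have [W [h1 [h1' [Wx e1]]]] := repr_germ Ux s.
by apply/germP; exists W, h1, h1'; rewrite !rmorphN e1.
Qed.

Definition stalk0 : stalk := @germ (oT X) I 0.
Definition stalk1 : stalk := @germ (oT X) I 1.

Lemma stalk0E (U : opens X) (Ux : U x) : stalk0 = germ Ux 0.
Proof.
by rewrite /stalk0 -(@germ_res (oT X) U I Ux (@subsetT _ _)) rmorph0.
Qed.

Lemma stalk1E (U : opens X) (Ux : U x) : stalk1 = germ Ux 1.
Proof.
by rewrite /stalk1 -(@germ_res (oT X) U I Ux (@subsetT _ _)) rmorph1.
Qed.

Lemma stalk_rep2 (a b : stalk) : exists (U : opens X) (Ux : U x) (s t : sec U),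
  a = germ Ux s /\ b = germ Ux t.
Proof.
have [U [Ux [s ->]]] := stalk_rep a; have [V [Vx [t ->]]] := stalk_rep b.
exists (oI U V), (conj Ux Vx), (res (@lsub _ _) s), (res (@rsub _ _) t).
by rewrite !germ_res.
Qed.

Lemma stalk_rep3 (a b c : stalk) :
  exists (U : opens X) (Ux : U x) (s t u : sec U),
  [/\ a = germ Ux s, b = germ Ux t & c = germ Ux u].
Proof.
have [U [Ux [s [t [-> ->]]]]] := stalk_rep2 a b.
have [V [Vx [u ->]]] := stalk_rep c.
exists (oI U V), (conj Ux Vx), (res (@lsub _ _) s), (res (@lsub _ _) t).
by exists (res (@rsub _ _) u); rewrite !germ_res.
Qed.

Fact stalk_addA : associative stalk_add.
Proof.
move=> a b c; have [U [Ux [s [t [u [-> -> ->]]]]]] := stalk_rep3 a b c.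
by rewrite !stalk_addE addrA.
Qed.

Fact stalk_addC : commutative stalk_add.
Proof.
move=> a b; have [U [Ux [s [t [-> ->]]]]] := stalk_rep2 a b.
by rewrite !stalk_addE addrC.
Qed.

Fact stalk_add0 : left_id stalk0 stalk_add.
Proof.
move=> a; have [U [Ux [s ->]]] := stalk_rep a.
by rewrite (stalk0E Ux) stalk_addE add0r.
Qed.

Fact stalk_addN : left_inverse stalk0 stalk_opp stalk_add.
Proof.
move=> a; have [U [Ux [s ->]]] := stalk_rep a.
by rewrite (stalk0E Ux) stalk_oppE stalk_addE addNr.
Qed.

HB.instance Definition _ :=
  GRing.isZmodule.Build stalk stalk_addA stalk_addC stalk_add0 stalk_addN.

Fact stalk_mulA : associative stalk_mul.
Proof.
move=> a b c; have [U [Ux [s [t [u [-> -> ->]]]]]] := stalk_rep3 a b c.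
by rewrite !stalk_mulE mulrA.
Qed.

Fact stalk_mulC : commutative stalk_mul.
Proof.
move=> a b; have [U [Ux [s [t [-> ->]]]]] := stalk_rep2 a b.
by rewrite !stalk_mulE mulrC.
Qed.

Fact stalk_mul1 : left_id stalk1 stalk_mul.
Proof.
move=> a; have [U [Ux [s ->]]] := stalk_rep a.
by rewrite (stalk1E Ux) stalk_mulE mul1r.
Qed.

Fact stalk_mulD : left_distributive stalk_mul +%R.
Proof.
move=> a b c; have [U [Ux [s [t [u [-> -> ->]]]]]] := stalk_rep3 a b c.
by rewrite -[_ + _]/(stalk_add _ _) -[RHS]/(stalk_add _ _)
  !(stalk_addE, stalk_mulE) mulrDl.
Qed.

HB.instance Definition _ := GRing.Zmodule_isComPzRing.Build stalk
  stalk_mulA stalk_mulC stalk_mul1 stalk_mulD.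

End Stalk.
Arguments germ {k X x U} Ux s.

(* Morphisms of locally ringed spaces over k. The map of sheaves
   O_Y -> f_* O_X is given in the form of its components O_Y(U) -> O_X(V) for
   all V contained in f^-1(U), the case V = f^-1(U) followed by restriction;
   this avoids identifying preimages along equal maps. *)
Record morphism (k : fieldType) (X Y : kspace k) := Morphism {
  mfun :> X -> Y;
  mcont : continuous mfun;
  comap : forall (U : opens Y) (V : opens X),
    V `<=` mfun @^-1` U -> {rmorphism sec U -> sec V};
  comap_res : forall (U U' : opens Y) (V V' : opens X)
    (h : V `<=` mfun @^-1` U) (h' : V' `<=` mfun @^-1` U')
    (u : U' `<=` U) (v : V' `<=` V) s,
    res v (comap h s) = comap h' (res u s);
  comap_scal : forall (U : opens Y) (V : opens X) (h : V `<=` mfun @^-1` U) c,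
    comap h (scal U c) = scal V c;
  comap_local : forall x (U : opens Y) (V : opens X)
    (h : V `<=` mfun @^-1` U) (Vx : V x) (Ufx : U (mfun x)) s,
    invertible (germ Vx (comap h s)) -> invertible (germ Ufx s)
}.
Arguments comap {k X Y} m {U V} h : rename.

Section Morphisms.
Variable k : fieldType.
Implicit Types X Y Z : kspace k.

Fact preim_open X Y (f : morphism X Y) (U : opens Y) : open (f @^-1` U).
Proof. by have /continuousP := @mcont _ _ _ f; apply; exact: opens_open. Qed.

Definition preim X Y (f : morphism X Y) (U : opens Y) : opens X :=
  @Opens X (f @^-1` U) (preim_open f U).

Definition morphism_eq X Y (f g : morphism X Y) : Prop :=
  (forall x, f x = g x) /\
  forall (U : opens Y) (V : opens X) (h : V `<=` f @^-1` U)
    (h' : V `<=` g @^-1` U) s, comap f h s = comap g h' s.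

Section Identity.
Variable X : kspace k.

Fact mid_cont : continuous (@id X).
Proof. by move=> x; exact: cvg_id. Qed.

Fact mid_local x (U V : opens X) (h : V `<=` id @^-1` U) (Vx : V x)
  (Ux : U x) (s : sec U) : invertible (germ Vx (res h s)) -> invertible (germ Ux s).
Proof. by rewrite (@germ_res _ _ _ U V Ux). Qed.

Definition mid : morphism X X :=
  @Morphism k X X id mid_cont (fun U V h => res h)
    (fun U U' V V' h h' u v s =>
       etrans (res_res h v (subset_trans v h) s)
         (esym (res_res u h' (subset_trans v h) s)))
    (fun U V h c => res_scal h c) mid_local.

End Identity.

Section Composition.
Variables (X Y Z : kspace k) (g : morphism Y Z) (f : morphism X Y).

Fact mcomp_cont : continuous (g \o f).
Proof. by move=> x; apply: continuous_comp; exact: mcont. Qed.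

Definition mcomp_comap (U : opens Z) (V : opens X)
    (h : V `<=` (g \o f) @^-1` U) : {rmorphism sec U -> sec V} :=
  GRing.RMorphism.clone _ _
    (@comap _ _ _ f (preim g U) V h
       \o @comap _ _ _ g U (preim g U) (@subset_refl _ _)) _.

Fact mcomp_res (U U' : opens Z) (V V' : opens X)
    (h : V `<=` (g \o f) @^-1` U) (h' : V' `<=` (g \o f) @^-1` U')
    (u : U' `<=` U) (v : V' `<=` V) s :
  res v (mcomp_comap h s) = mcomp_comap h' (res u s).
Proof.
have w : preim g U' `<=` preim g U by move=> y /u.
rewrite /= (@comap_res _ _ _ f _ (preim g U') _ _ _ h' w).
congr (comap f _ _).
exact: (@comap_res _ _ _ g U U' (preim g U) (preim g U')).
Qed.

Fact mcomp_scal (U : opens Z) (V : opens X) (h : V `<=` (g \o f) @^-1` U) c :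
  mcomp_comap h (scal U c) = scal V c.
Proof. by rewrite /= !comap_scal. Qed.

Fact mcomp_local x (U : opens Z) (V : opens X) (h : V `<=` (g \o f) @^-1` U)
    (Vx : V x) (Ux : U ((g \o f) x)) s :
  invertible (germ Vx (mcomp_comap h s)) -> invertible (germ Ux s).
Proof.
move=> /(@comap_local _ _ _ f x (preim g U) V h Vx Ux).
exact: (@comap_local _ _ _ g (f x) U (preim g U)).
Qed.

Definition mcomp : morphism X Z :=
  Morphism mcomp_cont mcomp_res mcomp_scal mcomp_local.

End Composition.

Definition isomorphism X Y (f : morphism X Y) : Prop :=
  exists g : morphism Y X,
    morphism_eq (mcomp g f) (mid X) /\ morphism_eq (mcomp f g) (mid Y).

(* the set D(s) of points where s does not vanish *)
Definition basic_open X (U : opens X) (s : sec U) : set X :=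
  [set x | exists Ux : U x, invertible (germ Ux s)].

(* The canonical morphism U -> Spec O(U), sending x to the prime ideal of the
   sections that are not invertible at x, is an isomorphism: it is bijective,
   the sets D(s) form a basis of the topology of U, and the sections over D(s)
   are O(U)[1/s]. *)
Definition affine X (U : opens X) : Prop :=
  [/\ forall P : sec U -> Prop, prime_ideal P ->
        exists! x, exists Ux : U x, forall s, P s <-> nonunit (germ Ux s),
      forall (W : opens X) x, W `<=` U -> W x ->
        exists s : sec U, basic_open s x /\ basic_open s `<=` W &
      forall (s : sec U) (V : opens X) (h : V `<=` U),
        oset V = basic_open s -> localization_at (res h) s].

End Morphisms.

Record scheme (k : fieldType) := Scheme {
  scheme_space :> kspace k;
  scheme_local : forall x : scheme_space, local_ring (stalk x);
  scheme_affine : forall x : scheme_space,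
    exists2 U : opens scheme_space, affine U & U x
}.

Section Schemes.
Variable k : fieldType.
Implicit Types X Y Z S T : scheme k.

Definition integral X : Prop :=
  (exists x : X, True) /\
  forall U : opens X, (exists x, U x) -> domain (sec U).

Definition is_fibre_product X Y S (f : morphism X S) (g : morphism Y S)
    (P : scheme k) (p : morphism P X) (q : morphism P Y) : Prop :=
  morphism_eq (mcomp f p) (mcomp g q) /\
  forall T (a : morphism T X) (b : morphism T Y),
    morphism_eq (mcomp f a) (mcomp g b) ->
    exists c : morphism T P,
      [/\ morphism_eq (mcomp p c) a, morphism_eq (mcomp q c) b &
          forall c' : morphism T P,
            morphism_eq (mcomp p c') a -> morphism_eq (mcomp q c') b ->
            morphism_eq c' c].

(* the fibre product over the final object Spec k *)
Definition is_product X Y (P : scheme k) (p : morphism P X) (q : morphism P Y) :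
    Prop :=
  forall T (a : morphism T X) (b : morphism T Y),
    exists c : morphism T P,
      [/\ morphism_eq (mcomp p c) a, morphism_eq (mcomp q c) b &
          forall c' : morphism T P,
            morphism_eq (mcomp p c') a -> morphism_eq (mcomp q c') b ->
            morphism_eq c' c].

(* The diagonal of a morphism of schemes is a locally closed immersion; it is
   a closed immersion if and only if its image is closed. *)
Definition separated X Y (f : morphism X Y) : Prop :=
  exists (P : scheme k) (p q : morphism P X) (d : morphism X P),
    [/\ is_fibre_product f f p q, morphism_eq (mcomp p d) (mid X),
        morphism_eq (mcomp q d) (mid X) & closed (range d)].

Definition separated_over_k X : Prop :=
  exists (P : scheme k) (p q : morphism P X) (d : morphism X P),
    [/\ is_product p q, morphism_eq (mcomp p d) (mid X),
        morphism_eq (mcomp q d) (mid X) & closed (range d)].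

Definition finite_type X Y (f : morphism X Y) : Prop :=
  forall y : Y, exists U : opens Y, [/\ affine U, U y &
    exists n (V : 'I_n -> opens X), (forall x, U (f x) <-> exists i, V i x) /\
      forall i, affine (V i) /\
        exists h : V i `<=` f @^-1` U, fg_algebra (comap f h)].

Definition finite_type_over_k X : Prop :=
  exists n (V : 'I_n -> opens X), (forall x, exists i, V i x) /\
    forall i, affine (V i) /\ fg_algebra (scal (V i)).

Definition universally_closed X Y (f : morphism X Y) : Prop :=
  forall T (t : morphism T Y) (P : scheme k) (p : morphism P X)
    (q : morphism P T), is_fibre_product f t p q ->
  forall C : set P, closed C -> closed (q @` C).

Definition proper X Y (f : morphism X Y) : Prop :=
  [/\ separated f, finite_type f & universally_closed f].

(* f restricts to an isomorphism of the open subscheme V onto U *)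
Definition iso_between X Y (f : morphism X Y) (V : opens X) (U : opens Y) :
    Prop :=
  [/\ V `<=` f @^-1` U,
      forall y, U y -> exists! x, V x /\ f x = y,
      forall W : opens X, W `<=` V -> open (f @` W) &
      forall (U' : opens Y) (V' : opens X) (h : V' `<=` f @^-1` U'),
        U' `<=` U -> oset V' = V `&` f @^-1` U' -> bijective (comap f h)].

(* for integral schemes, where the nonempty open subsets are dense *)
Definition birational X Y (f : morphism X Y) : Prop :=
  exists (V : opens X) (U : opens Y),
    [/\ exists x, V x, exists y, U y & iso_between f V U].

Definition integral_variety X : Prop :=
  [/\ integral X, separated_over_k X & finite_type_over_k X].

Definition nonsingular X : Prop :=
  forall x : X, regular_local_ring (stalk x).

End Schemes.

Record omod (k : fieldType) (X : kspace k) := OMod {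
  msec :> forall U : opens X, lmodType (sec U);
  mres : forall U V : opens X, V `<=` U -> {additive msec U -> msec V};
  mresZ : forall (U V : opens X) (h : V `<=` U) a m,
    mres h (a *: m) = res h a *: mres h m;
  mres_id : forall (U : opens X) (h : U `<=` U) m, mres h m = m;
  mres_mres : forall (U V W : opens X) (h : V `<=` U) (h' : W `<=` V)
    (h'' : W `<=` U) m, mres h' (mres h m) = mres h'' m;
  msec_sep : forall U C, covers C U -> forall m n : msec U,
    (forall (V : opens X) (h : V `<=` U), C V -> mres h m = mres h n) -> m = n;
  msec_glue : forall U C, covers C U -> forall m : (forall V, msec V),
    (forall (V V' W : opens X) (h : W `<=` V) (h' : W `<=` V'), C V -> C V' ->
       mres h (m V) = mres h' (m V')) ->
    exists t : msec U, forall (V : opens X) (h : V `<=` U), C V ->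
      mres h t = m V
}.
Arguments mres {k X} M {U V} h : rename.

Record mhom (k : fieldType) (X : kspace k) (M N : omod X) := MHom {
  hfun :> forall U : opens X, {linear M U -> N U};
  hfun_res : forall (U V : opens X) (h : V `<=` U) m,
    mres N h (hfun U m) = hfun V (mres M h m)
}.

(* An O_X-linear map M -> f_* N, with components M(U) -> N(V) for all V
   contained in f^-1(U). *)
Record cohom (k : fieldType) (Z X : kspace k) (f : morphism Z X)
    (M : omod X) (N : omod Z) := CoHom {
  cfun :> forall (U : opens X) (V : opens Z),
    V `<=` f @^-1` U -> {additive M U -> N V};
  cfunZ : forall (U : opens X) (V : opens Z) (h : V `<=` f @^-1` U) a m,
    cfun h (a *: m) = comap f h a *: cfun h m;
  cfun_res : forall (U U' : opens X) (V V' : opens Z)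
    (h : V `<=` f @^-1` U) (h' : V' `<=` f @^-1` U')
    (u : U' `<=` U) (v : V' `<=` V) m,
    mres N v (cfun h m) = cfun h' (mres M u m)
}.

(* f^* is left adjoint to f_*; u is the unit M -> f_* f^* M. *)
Definition is_pullback (k : fieldType) (Z X : kspace k) (f : morphism Z X)
    (M : omod X) (N : omod Z) (u : cohom f M N) : Prop :=
  forall (P : omod Z) (v : cohom f M P), exists w : mhom N P,
    (forall (U : opens X) (V : opens Z) (h : V `<=` f @^-1` U) m,
       w V (u U V h m) = v U V h m) /\
    forall w' : mhom N P,
      (forall (U : opens X) (V : opens Z) (h : V `<=` f @^-1` U) m,
         w' V (u U V h m) = v U V h m) ->
      forall V n, w' V n = w V n.

Section Torsion.
Variables (k : fieldType) (Z : kspace k) (N : omod Z).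

(* the torsion subsheaf, for Z integral *)
Definition torsion (V : opens Z) (n : N V) : Prop :=
  forall x, V x -> exists (W : opens Z) (h : W `<=` V) (a : sec W),
    [/\ W x, a <> 0 & a *: mres N h n = 0].

(* The quotient sheaf N/tor is locally free of rank r: locally there are
   sections e_1, ..., e_r of N such that the map O^r -> N/tor they define is
   surjective (as a map of sheaves) and injective. *)
Definition mod_torsion_locally_free (r : nat) : Prop :=
  forall z : Z, exists (V : opens Z) (e : 'I_r -> N V), [/\ V z,
    forall (W : opens Z) (h : W `<=` V) (n : N W) x, W x ->
      exists (W' : opens Z) (g : W' `<=` W) (g' : W' `<=` V)
        (c : 'I_r -> sec W'), W' x /\
        torsion (mres N g n - \sum_i c i *: mres N g' (e i)) &
    forall (W : opens Z) (h : W `<=` V) (c : 'I_r -> sec W),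
      torsion (\sum_i c i *: mres N h (e i)) -> forall i, c i = 0].

(* For Z integral with generic point eta, the stalk of N at eta has dimension r
   over the function field: the sections e_i induce a basis of it. *)
Definition generic_rank (r : nat) : Prop :=
  exists (V : opens Z) (e : 'I_r -> N V), [/\ exists z, V z,
    forall (W : opens Z) (h : W `<=` V) (n : N W), (exists x, W x) ->
      exists (W' : opens Z) (g : W' `<=` W) (g' : W' `<=` V)
        (c : 'I_r -> sec W'), (exists x, W' x) /\
        mres N g n = \sum_i c i *: mres N g' (e i) &
    forall (W : opens Z) (h : W `<=` V) (c : 'I_r -> sec W), (exists x, W x) ->
      \sum_i c i *: mres N h (e i) = 0 -> forall i, c i = 0].

End Torsion.

Definition flattens (k : fieldType) (Z X : kspace k) (f : morphism Z X)
    (M : omod X) (r : nat) : Prop :=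
  exists (N : omod Z) (u : cohom f M N),
    is_pullback u /\ mod_torsion_locally_free N r.

(* X is meant to be integral; r is then determined by M. *)
Definition is_blowup (k : fieldType) (X B : scheme k) (M : omod X)
    (f : morphism B X) : Prop :=
  [/\ integral B, proper f, birational f &
      exists r, [/\ generic_rank M r, flattens f M r &
        forall (Z : scheme k) (s : morphism Z X), integral Z -> flattens s M r ->
          exists b : morphism Z B, morphism_eq (mcomp f b) s /\
            forall b' : morphism Z B, morphism_eq (mcomp f b') s ->
              morphism_eq b' b]].

Section Derivations.
Variables (k : fieldType) (X : kspace k).

(* k-derivations of the sheaf O_U *)
Record dersec (U : opens X) := DerSec {
  dfun : forall V : opens X, V `<=` U -> sec V -> sec V;
  dfunP : forall (V : opens X) (h : V `<=` U), derivation (scal V) (dfun h);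
  dfun_res : forall (V W : opens X) (h : V `<=` U) (h' : W `<=` U)
    (g : W `<=` V) s, res g (dfun h s) = dfun h' (res g s)
}.

HB.instance Definition _ U := gen_eqMixin (dersec U).
HB.instance Definition _ U := gen_choiceMixin (dersec U).

Lemma dersecP (U : opens X) (D E : dersec U) :
  (forall (V : opens X) (h : V `<=` U) s, dfun D h s = dfun E h s) -> D = E.
Proof.
case: D E => d d1 d2 [e e1 e2] /= de.
have ? : d = e.
  by apply: functional_extensionality_dep => V; do 2 apply: funext => ?.
by subst e; congr DerSec; exact: Prop_irrelevance.
Qed.

Section Operations.
Variable U : opens X.
Implicit Types (D E F : dersec U) (a b : sec U).

Fact der0P (V : opens X) (h : V `<=` U) : derivation (scal V) (fun=> 0).
Proof. by split=> * /=; rewrite ?mulr0 ?addr0. Qed.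

Fact doppP D (V : opens X) (h : V `<=` U) :
  derivation (scal V) (fun s => - dfun D h s).
Proof.
have [d1 d2 d3] := dfunP D h; split=> [s t|s t|c].
- by rewrite d1 opprD.
- by rewrite d2 opprD !mulrN.
- by rewrite d3 oppr0.
Qed.

Fact daddP D E (V : opens X) (h : V `<=` U) :
  derivation (scal V) (fun s => dfun D h s + dfun E h s).
Proof.
have [d1 d2 d3] := dfunP D h; have [e1 e2 e3] := dfunP E h.
split=> [s t|s t|c].
- by rewrite d1 e1 addrACA.
- by rewrite d2 e2 addrACA !mulrDr.
- by rewrite d3 e3 addr0.
Qed.

Fact dscaleP a D (V : opens X) (h : V `<=` U) :
  derivation (scal V) (fun s => res h a * dfun D h s).
Proof.
have [d1 d2 d3] := dfunP D h; split=> [s t|s t|c].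
- by rewrite d1 mulrDr.
- by rewrite d2 mulrDr mulrCA [X in _ + X]mulrCA.
- by rewrite d3 mulr0.
Qed.

Section Restriction.
Variables (V W : opens X) (h : V `<=` U) (h' : W `<=` U) (g : W `<=` V).

Fact der0_res (s : sec V) : res g 0 = 0.
Proof. exact: rmorph0. Qed.

Fact dopp_res D s : res g (- dfun D h s) = - dfun D h' (res g s).
Proof. by rewrite rmorphN (dfun_res D h h'). Qed.

Fact dadd_res D E s :
  res g (dfun D h s + dfun E h s) = dfun D h' (res g s) + dfun E h' (res g s).
Proof. by rewrite rmorphD (dfun_res D h h') (dfun_res E h h'). Qed.

Fact dscale_res a D s :
  res g (res h a * dfun D h s) = res h' a * dfun D h' (res g s).
Proof. by rewrite rmorphM (dfun_res D h h') (res_res _ _ h'). Qed.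

End Restriction.

Definition der0 : dersec U := DerSec der0P (fun V W _ _ => @der0_res V W).
Definition dopp D : dersec U :=
  DerSec (doppP D) (fun V W h h' g => @dopp_res V W h h' g D).
Definition dadd D E : dersec U :=
  DerSec (daddP D E) (fun V W h h' g => @dadd_res V W h h' g D E).
Definition dscale a D : dersec U :=
  DerSec (dscaleP a D) (fun V W h h' g => @dscale_res V W h h' g a D).

Fact daddA : associative dadd.
Proof. by move=> D E F; apply: dersecP => V h s /=; rewrite addrA. Qed.
Fact daddC : commutative dadd.
Proof. by move=> D E; apply: dersecP => V h s /=; rewrite addrC. Qed.
Fact dadd0 : left_id der0 dadd.
Proof. by move=> D; apply: dersecP => V h s /=; rewrite add0r. Qed.
Fact daddN : left_inverse der0 dopp dadd.
Proof. by move=> D; apply: dersecP => V h s /=; rewrite addNr. Qed.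

HB.instance Definition _ :=
  GRing.isZmodule.Build (dersec U) daddA daddC dadd0 daddN.

Fact dscaleA a b D : dscale a (dscale b D) = dscale (a * b) D.
Proof. by apply: dersecP => V h s /=; rewrite rmorphM mulrA. Qed.
Fact dscale1 : left_id 1 dscale.
Proof. by move=> D; apply: dersecP => V h s /=; rewrite rmorph1 mul1r. Qed.
Fact dscaleDr : right_distributive dscale +%R.
Proof. by move=> a D E; apply: dersecP => V h s /=; rewrite mulrDr. Qed.
Fact dscaleDl D : {morph dscale^~ D : a b / a + b}.
Proof. by move=> a b; apply: dersecP => V h s /=; rewrite rmorphD mulrDl. Qed.

HB.instance Definition _ := GRing.Zmodule_isLmodule.Build (sec U) (dersec U)
  dscaleA dscale1 dscaleDr dscaleDl.

End Operations.

Definition dres_fun (U V : opens X) (h : V `<=` U) (D : dersec U) : dersec V :=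
  @DerSec V (fun W g => dfun D (subset_trans g h))
    (fun W g => dfunP D (subset_trans g h))
    (fun W W' g g' i => dfun_res D (subset_trans g h) (subset_trans g' h) i).

Fact dres_additive (U V : opens X) (h : V `<=` U) :
  zmod_morphism (dres_fun h).
Proof. by move=> D E; apply: dersecP. Qed.

HB.instance Definition _ (U V : opens X) (h : V `<=` U) :=
  GRing.isZmodMorphism.Build (dersec U) (dersec V) (dres_fun h)
    (dres_additive h).

Definition dres (U V : opens X) (h : V `<=` U) :
    {additive dersec U -> dersec V} := dres_fun h.

Lemma dfun_irr (U V : opens X) (D : dersec U) (h h' : V `<=` U) s :
  dfun D h s = dfun D h' s.
Proof. by congr (dfun D _ s); exact: Prop_irrelevance. Qed.

Fact dresZ (U V : opens X) (h : V `<=` U) a D :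
  dres h (a *: D) = res h a *: dres h D.
Proof.
by apply: dersecP => W g s /=; rewrite (res_res _ _ (subset_trans g h)).
Qed.

Fact dres_id (U : opens X) (h : U `<=` U) D : dres h D = D.
Proof. by apply: dersecP => W g s /=; exact: dfun_irr. Qed.

Fact dres_dres (U V W : opens X) (h : V `<=` U) (h' : W `<=` V)
  (h'' : W `<=` U) D : dres h' (dres h D) = dres h'' D.
Proof. by apply: dersecP => W' g s /=; exact: dfun_irr. Qed.

Fact dersec_sep U C : covers C U -> forall D E : dersec U,
  (forall (V : opens X) (h : V `<=` U), C V -> dres h D = dres h E) -> D = E.
Proof.
move=> [CU UC] D E DE; apply: dersecP => V h s.
apply: (@sec_sep k X V (fun W => W `<=` V /\ exists2 V', C V' & W `<=` V')).
  split=> [W []//|x Vx]; have [V' CV' V'x] := UC x (h x Vx).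
  by exists (oI V V') => //; split=> [y []//|]; exists V' => // y [].
move=> W g [_ [V' CV' WV']].
rewrite !(dfun_res _ h (subset_trans g h)).
have /(congr1 (fun F => dfun F WV' (res g s))) := DE V' (CU _ CV') CV'.
by rewrite /= (dfun_irr D _ (subset_trans g h)) (dfun_irr E _ (subset_trans g h)).
Qed.

Fact dersec_glue U C : covers C U -> forall D : (forall V, dersec V),
  (forall (V V' W : opens X) (h : W `<=` V) (h' : W `<=` V'), C V -> C V' ->
     dres h (D V) = dres h' (D V')) ->
  exists E : dersec U, forall (V : opens X) (h : V `<=` U), C V ->
    dres h E = D V.
Proof.
move=> [CU UC] D Dcompat.
pose CW (W W' : opens X) := W' `<=` W /\ exists2 V, C V & W' `<=` V.
have CWcov (W : opens X) : W `<=` U -> covers (CW W) W.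
  move=> WU; split=> [W' []//|x Wx]; have [V CV Vx] := UC x (WU x Wx).
  by exists (oI W V) => //; split=> [y []//|]; exists V => // y [].
have agree (W V V' : opens X) (h : W `<=` V) (h' : W `<=` V') s :
    C V -> C V' -> dfun (D V) h s = dfun (D V') h' s.
  move=> CV CV'.
  have /(congr1 (fun F => dfun F (@subset_refl _ _) s)) :=
    Dcompat V V' W h h' CV CV'.
  by rewrite /= (dfun_irr _ _ h) (dfun_irr _ _ h').
have glue (W : opens X) (WU : W `<=` U) (s : sec W) : exists t : sec W,
    forall (W' V : opens X) (g : W' `<=` W) (h : W' `<=` V), C V ->
      res g t = dfun (D V) h (res g s).
  have loc (W' : opens X) : {v : sec W' | forall (g : W' `<=` W)
      (V : opens X) (h : W' `<=` V), C V -> v = dfun (D V) h (res g s)}.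
    apply: cid.
    have [[g [V CV h]]|no] := pselect (CW W W').
      exists (dfun (D V) h (res g s)) => g' V' h' CV'.
      by rewrite (agree _ _ _ h h') // (Prop_irrelevance g g').
    by exists 0 => g V h CV; case: no; split=> //; exists V.
  have [|t tP] := @sec_glue k X W (CW W) (CWcov W WU) (fun W' => sval (loc W')).
    move=> W1 W2 W3 h1 h2 [g1 [V1 CV1 i1]] [g2 [V2 CV2 i2]].
    rewrite (svalP (loc W1) g1 V1 i1 CV1) (svalP (loc W2) g2 V2 i2 CV2).
    have j1 := subset_trans h1 i1; have j2 := subset_trans h2 i2.
    rewrite (dfun_res _ _ j1) (dfun_res _ _ j2) (agree _ _ _ j1 j2) //.
    rewrite (res_res _ _ (subset_trans h1 g1)).
    by rewrite (res_res _ _ (subset_trans h1 g1)).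
  exists t => W' V g h CV.
  rewrite (tP W' g); last by split=> //; exists V.
  exact: (svalP (loc W') g V h CV).
pose d (W : opens X) (WU : W `<=` U) (s : sec W) := sval (cid (glue W WU s)).
have dE (W : opens X) (WU : W `<=` U) (s : sec W) (W' V : opens X)
    (g : W' `<=` W) (h : W' `<=` V) : C V ->
    res g (d W WU s) = dfun (D V) h (res g s).
  exact: (svalP (cid (glue W WU s))).
have dP (W : opens X) (WU : W `<=` U) : derivation (scal W) (d W WU).
  split=> [s t|s t|c]; apply: (sec_sep (CWcov W WU)) => W' g [_ [V CV h]];
    rewrite ?(rmorphD, rmorphM) !(dE _ _ _ _ _ g h CV);
    have [d1 d2 d3] := dfunP (D V) h.
  - by rewrite rmorphD d1.
  - by rewrite rmorphM d2.
  - by rewrite res_scal d3 rmorph0.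
have dR (V W : opens X) (h : V `<=` U) (h' : W `<=` U) (g : W `<=` V) s :
    res g (d V h s) = d W h' (res g s).
  apply: (sec_sep (CWcov W h')) => W' i [_ [V' CV' j]].
  rewrite (dE _ _ _ _ _ i j CV') (res_res _ _ (subset_trans i g)).
  by rewrite (dE _ _ _ _ _ _ j CV') (res_res _ _ (subset_trans i g)).
exists (DerSec dP dR) => V h CV; apply: dersecP => W g s /=.
rewrite -[LHS](res_id (@subset_refl _ _)) (dE _ _ _ _ _ _ g CV).
by rewrite res_id.
Qed.

Definition Der : omod X :=
  @OMod k X (fun U => dersec U) dres dresZ dres_id dres_dres
    dersec_sep dersec_glue.

End Derivations.

(* The next section checks that Der_k(O_X), as defined above, is the
   dual of the sheaf of Kaehler differentials Omega_{X/k}, the latter being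
   defined by its universal property; see [dual_to_der_bij]. *)

Section Kaehler.
Variables (k : fieldType) (X : kspace k).

(* k-derivations of O_X with values in an O_X-module *)
Record mderivation (P : omod X) := MDerivation {
  mdfun :> forall U : opens X, sec U -> P U;
  mdfunD : forall (U : opens X) (s t : sec U),
    mdfun (s + t) = mdfun s + mdfun t;
  mdfunM : forall (U : opens X) (s t : sec U),
    mdfun (s * t) = s *: mdfun t + t *: mdfun s;
  mdfun_scal : forall (U : opens X) c, mdfun (scal U c) = 0;
  mdfun_res : forall (U V : opens X) (h : V `<=` U) s,
    mres P h (mdfun s) = mdfun (res h s)
}.
Arguments mdfun {P} m {U} s.

Definition is_kaehler (Omega : omod X) (d : mderivation Omega) : Prop :=
  forall (P : omod X) (D : mderivation P), exists w : mhom Omega P,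
    (forall (U : opens X) (s : sec U), w U (mdfun d s) = mdfun D s) /\
    forall w' : mhom Omega P,
      (forall (U : opens X) (s : sec U), w' U (mdfun d s) = mdfun D s) ->
      forall U m, w' U m = w U m.

(* sections over U of the dual Hom(M, O_X): linear maps M|_U -> O_U *)
Record dualsec (M : omod X) (U : opens X) := DualSec {
  dualfun : forall V : opens X, V `<=` U -> M V -> sec V;
  dualfunD : forall (V : opens X) (h : V `<=` U) m n,
    dualfun h (m + n) = dualfun h m + dualfun h n;
  dualfunZ : forall (V : opens X) (h : V `<=` U) a m,
    dualfun h (a *: m) = a * dualfun h m;
  dualfun_res : forall (V W : opens X) (h : V `<=` U) (h' : W `<=` U)
    (g : W `<=` V) m, res g (dualfun h m) = dualfun h' (mres M g m)
}.

Section DirectImage.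
Variable U : opens X.

(* the direct image j_* O_U along the inclusion j of U *)
Definition jsec (W : opens X) : Type := sec (oI W U).
HB.instance Definition _ W := GRing.ComPzRing.on (jsec W).

Let iW (W : opens X) : oI W U `<=` W := @subIsetl _ W U.
Let iU (W : opens X) : oI W U `<=` U := @subIsetr _ W U.

Fact oI_sub (V W : opens X) (h : V `<=` W) : oI V U `<=` oI W U.
Proof. by move=> x [/h]. Qed.

Definition jscale (W : opens X) (a : sec W) (m : jsec W) : jsec W :=
  res (@iW W) a * m.

Fact jscaleA (W : opens X) (a b : sec W) (m : jsec W) :
  jscale a (jscale b m) = jscale (a * b) m.
Proof. by rewrite /jscale rmorphM mulrA. Qed.
Fact jscale1 (W : opens X) : left_id 1 (@jscale W).
Proof. by move=> m; rewrite /jscale rmorph1 mul1r. Qed.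
Fact jscaleDr (W : opens X) : right_distributive (@jscale W) +%R.
Proof. by move=> a m n; rewrite /jscale mulrDr. Qed.
Fact jscaleDl (W : opens X) (m : jsec W) : {morph (@jscale W)^~ m : a b / a + b}.
Proof. by move=> a b; rewrite /jscale rmorphD mulrDl. Qed.

HB.instance Definition _ W := GRing.Zmodule_isLmodule.Build (sec W) (jsec W)
  (@jscaleA W) (@jscale1 W) (@jscaleDr W) (@jscaleDl W).

Definition jres (W V : opens X) (h : V `<=` W) : {additive jsec W -> jsec V} :=
  res (oI_sub h).

Fact jresZ (W V : opens X) (h : V `<=` W) a m :
  jres h (a *: m) = res h a *: jres h m.
Proof.
rewrite /jres /= [a *: m]/(res _ _ * _) rmorphM /=.
rewrite -[RHS]/(res (@iW V) (res h a) * _).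
have g : oI V U `<=` W by move=> x [/h].
by rewrite !(res_res _ _ g).
Qed.

Fact jres_id (W : opens X) (h : W `<=` W) m : jres h m = m.
Proof. exact: res_id. Qed.

Fact jres_jres (W V Z : opens X) (h : V `<=` W) (h' : Z `<=` V) (h'' : Z `<=` W)
  m : jres h' (jres h m) = jres h'' m.
Proof. exact: res_res. Qed.

Let trace (C : opens X -> Prop) (V : opens X) : Prop :=
  exists2 W, C W & oset V = oset (oI W U).

Fact trace_covers C W : covers C W -> covers (trace C) (oI W U).
Proof.
move=> [CW WC]; split=> [V [Z CZ ->]|x [/WC[Z CZ Zx] Ux]].
  exact: oI_sub (CW Z CZ).
by exists (oI Z U) => //; exists Z.
Qed.

Fact jsec_sep W C : covers C W -> forall m n : jsec W,
  (forall (V : opens X) (h : V `<=` W), C V -> jres h m = jres h n) -> m = n.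
Proof.
move=> cov m n mn; apply: (sec_sep (trace_covers cov)) => V h [Z CZ e].
have VZ : V `<=` oI Z U by rewrite e.
have := congr1 (res VZ) (mn Z (cov.1 _ CZ) CZ).
by rewrite !(res_res _ _ h).
Qed.

Fact jsec_glue W C : covers C W -> forall m : (forall V, jsec V),
  (forall (V V' Z : opens X) (h : Z `<=` V) (h' : Z `<=` V'), C V -> C V' ->
     jres h (m V) = jres h' (m V')) ->
  exists t : jsec W, forall (V : opens X) (h : V `<=` W), C V ->
    jres h t = m V.
Proof.
move=> cov m mcompat.
have agree (V V' Z : opens X) (h : Z `<=` oI V U) (h' : Z `<=` oI V' U) :
    C V -> C V' -> res h (m V) = res h' (m V').
  move=> CV CV'.
  have g : oI V V' `<=` V by move=> x [].
  have g' : oI V V' `<=` V' by move=> x [].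
  have i : Z `<=` oI (oI V V') U by move=> x Zx; case: (h x Zx) (h' x Zx) => ? ? [].
  have := congr1 (res i) (mcompat V V' (oI V V') g g' CV CV').
  by rewrite /jres (res_res _ _ h) (res_res _ _ h').
have loc (V : opens X) : {v : sec V | forall (Z : opens X) (h : V `<=` oI Z U),
    C Z -> v = res h (m Z)}.
  apply: cid; have [[Z [CZ h]]|no] := pselect (exists Z, C Z /\ V `<=` oI Z U).
    by exists (res h (m Z)) => Z' h' CZ'; exact: agree.
  by exists 0 => Z h CZ; case: no; exists Z.
have [|t tP] := sec_glue (trace_covers cov) (s := fun V => sval (loc V)).
  move=> V1 V2 V3 h1 h2 [Z1 CZ1 e1] [Z2 CZ2 e2].
  have i1 : V1 `<=` oI Z1 U by rewrite e1.
  have i2 : V2 `<=` oI Z2 U by rewrite e2.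
  rewrite (svalP (loc V1) Z1 i1 CZ1) (svalP (loc V2) Z2 i2 CZ2).
  rewrite (res_res _ _ (subset_trans h1 i1)) (res_res _ _ (subset_trans h2 i2)).
  exact: agree.
exists t => V h CV; have /= -> := tP (oI V U) (oI_sub h); last by exists V.
by rewrite (svalP (loc _) V (@subset_refl _ _) CV) res_id.
Qed.

Definition direct_image : omod X :=
  @OMod k X (fun W => jsec W) jres jresZ jres_id jres_jres jsec_sep jsec_glue.

End DirectImage.

Section Duality.
Variables (Omega : omod X) (d : mderivation Omega) (U : opens X).

Fact dual_derivation (phi : dualsec Omega U) (V : opens X) (h : V `<=` U) :
  derivation (scal V) (fun s => dualfun phi h (mdfun d s)).
Proof.
split=> [s t|s t|c].
- by rewrite mdfunD dualfunD.
- by rewrite mdfunM dualfunD !dualfunZ.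
- by rewrite mdfun_scal -(scale0r 0) dualfunZ mul0r.
Qed.

Fact dual_derivation_res (phi : dualsec Omega U) (V W : opens X)
    (h : V `<=` U) (h' : W `<=` U) (g : W `<=` V) s :
  res g (dualfun phi h (mdfun d s)) = dualfun phi h' (mdfun d (res g s)).
Proof. by rewrite (dualfun_res phi h h') mdfun_res. Qed.

Definition dual_to_der (phi : dualsec Omega U) : Der X U :=
  DerSec (dual_derivation phi) (dual_derivation_res phi).

Let iU (W : opens X) : oI W U `<=` U := @subIsetr _ W U.
Let iW (W : opens X) : oI W U `<=` W := @subIsetl _ W U.

Lemma dualsecP (phi psi : dualsec Omega U) :
  (forall (V : opens X) (h : V `<=` U) m, dualfun phi h m = dualfun psi h m) ->
  phi = psi.
Proof.
case: phi psi => f f1 f2 f3 [g g1 g2 g3] /= fg.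
have ? : f = g.
  by apply: functional_extensionality_dep => V; do 2 apply: funext => ?.
by subst g; congr DualSec; exact: Prop_irrelevance.
Qed.

Section DualHom.
Variable phi : dualsec Omega U.

Definition dual_hom_fun (W : opens X) (m : Omega W) : direct_image U W :=
  dualfun phi (@iU W) (mres Omega (@iW W) m).

Fact dual_hom_linear W : linear (@dual_hom_fun W).
Proof.
move=> a m n; rewrite /dual_hom_fun raddfD /= mresZ dualfunD dualfunZ.
by [].
Qed.

HB.instance Definition _ W := GRing.isLinear.Build (sec W) (Omega W)
  (direct_image U W) *:%R (@dual_hom_fun W) (@dual_hom_linear W).

Fact dual_hom_res (W V : opens X) (h : V `<=` W) m :
  mres (direct_image U) h (dual_hom_fun m) = dual_hom_fun (mres Omega h m).
Proof.
rewrite /dual_hom_fun /= /jres (dualfun_res _ _ (@iU V)).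
by rewrite !(mres_mres _ _ (subset_trans (@iW V) h)).
Qed.

Definition dual_hom : mhom Omega (direct_image U) :=
  @MHom k X Omega (direct_image U) (fun W => @dual_hom_fun W) dual_hom_res.

End DualHom.

Section DerToDual.
Variable D : Der X U.

Definition jder_fun (W : opens X) (s : sec W) : direct_image U W :=
  dfun D (@iU W) (res (@iW W) s).

Fact jder_add (W : opens X) (s t : sec W) :
  jder_fun (s + t) = jder_fun s + jder_fun t.
Proof.
have [d1 _ _] := dfunP D (@iU W); rewrite /jder_fun rmorphD d1; by [].
Qed.

Fact jder_mul (W : opens X) (s t : sec W) :
  jder_fun (s * t) = s *: jder_fun t + t *: jder_fun s.
Proof.
have [_ d2 _] := dfunP D (@iU W); rewrite /jder_fun rmorphM d2; by [].
Qed.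

Fact jder_scal (W : opens X) c : jder_fun (scal W c) = 0.
Proof.
have [_ _ d3] := dfunP D (@iU W); rewrite /jder_fun res_scal d3; by [].
Qed.

Fact jder_res (W V : opens X) (h : V `<=` W) s :
  mres (direct_image U) h (jder_fun s) = jder_fun (res h s).
Proof.
rewrite /jder_fun /= /jres (dfun_res _ _ (@iU V)).
by rewrite !(res_res _ _ (subset_trans (@iW V) h)).
Qed.

Definition jder : mderivation (direct_image U) :=
  @MDerivation (direct_image U) jder_fun jder_add jder_mul jder_scal jder_res.

End DerToDual.

Lemma dual_to_der_bij : is_kaehler d -> bijective dual_to_der.
Proof.
move=> univ.
have sub (V : opens X) (h : V `<=` U) : V `<=` oI V U.
  by move=> x Vx; split=> //; exact: h.
have inj : injective dual_to_der.
  move=> phi psi e; apply: dualsecP => V h m.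
  have [w [_ wU]] := univ _ (jder (dual_to_der phi)).
  have phiE : forall W (n : Omega W), dual_hom phi W n = w W n.
    by apply: wU => W s; rewrite /= /dual_hom_fun /jder_fun mdfun_res.
  have psiE : forall W (n : Omega W), dual_hom psi W n = w W n.
    by apply: wU => W s; rewrite e /= /dual_hom_fun /jder_fun mdfun_res.
  have hE (chi : dualsec Omega U) :
      res (sub V h) (dual_hom chi V m : sec (oI V U)) = dualfun chi h m.
    rewrite /= /dual_hom_fun (dualfun_res _ _ h).
    by rewrite (mres_mres _ _ (@subset_refl _ _)) mres_id.
  by rewrite -!hE phiE psiE.
have surj D : {phi | dual_to_der phi = D}.
  apply: cid; have [w [wd _]] := univ _ (jder D).
  pose f (V : opens X) (h : V `<=` U) (m : Omega V) : sec V :=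
    res (sub V h) (w V m : sec (oI V U)).
  have fD (V : opens X) (h : V `<=` U) m n : f V h (m + n) = f V h m + f V h n.
    by rewrite /f raddfD; exact: rmorphD.
  have fZ (V : opens X) (h : V `<=` U) a m : f V h (a *: m) = a * f V h m.
    rewrite /f linearZ; have := rmorphM (res (sub V h)) (res (@iW V) a) (w V m).
    by rewrite (res_res _ _ (@subset_refl _ _)) res_id.
  have fR (V W : opens X) (h : V `<=` U) (h' : W `<=` U) (g : W `<=` V) m :
      res g (f V h m) = f W h' (mres Omega g m).
    rewrite /f -hfun_res /= /jres (res_res _ _ (subset_trans g (sub V h))).
    by rewrite (res_res _ _ (subset_trans g (sub V h))).
  exists (DualSec fD fZ fR); apply: dersecP => V h s /=.
  rewrite /f wd /= /jder_fun (dfun_res _ _ h).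
  by rewrite (res_res _ _ (@subset_refl _ _)) res_id.
exists (fun D => sval (surj D)) => [phi|D]; last exact: (svalP (surj D)).
exact/inj/(svalP (surj (dual_to_der phi))).
Qed.

End Duality.

End Kaehler.

(* This is the conjecture in its local form. *)
Definition zariski_lipman (k : fieldType) : Prop :=
  forall Y : scheme k, integral_variety Y ->
  forall p : Y, der_free (@stalk_const k Y p) -> regular_local_ring (stalk p).

(* Main.v *)
Require Import Defs.
From HB Require Import structures.
From mathcomp Require Import all_boot all_algebra.
From mathcomp Require Import boolp classical_sets topology.
From mathcomp Require Import ring.

(** By its definition, the blow-up [f : B -> X] makes the pullback of the
    derivation sheaf locally free modulo torsion. If [f] is an isomorphism, the
    pullback is just a transport of structure, so that the derivation sheaf
    itself is locally free modulo torsion ([mod_torsion_locally_free_descends]).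
    On an integral scheme this sheaf has no torsion ([Der_torsion_eq0]), since
    restriction to a smaller nonempty open set is injective ([res_inj]); hence
    it is locally free. What remains is to pass to the stalk at a point [x] and
    apply the Zariski-Lipman conjecture there, and for this one has to know that
    the stalk of the derivation sheaf is the module of derivations of the local
    ring at [x].

    A derivation of sheaves near [x] acts on germs ([stalk_action]), and on an
    integral scheme it is determined by this action ([dersec_germ_eq0]). The
    point is that conversely every derivation [d] of the local ring extends to
    an open neighbourhood ([stalk_derivation_extends]). Here the finite type
    hypothesis enters. Take an affine neighbourhood [A] of [x] whose ring is
    generated over [k] by finitely many sections; the finitely many values of
    [d] on their germs are defined on a common neighbourhood [W] of [x], and by
    the Leibniz rule so are the values of [d] on all of [O(A)]. This gives a
    derivation from [O(A)] to [O(W)]. Every section over an open subset of [W]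
    is a fraction [b / c] with [b] and [c] in [O(A)], so the quotient rule
    forces the value of the extension; locally one may choose [c] invertible,
    and there the quotient rule does define a value ([derivation_extension]). *)

Set Implicit Arguments.
Unset Strict Implicit.
Unset Printing Implicit Defensive.
Import GRing.Theory.
Local Open Scope classical_set_scope.
Local Open Scope ring_scope.

(* the inverse image of open sets along a morphism, not that of predicates *)
Local Notation preim := Defs.preim.

(** * Sections and germs *)

Section Spaces.
Variables (k : fieldType) (X : kspace k).
Implicit Types U V W : opens X.

Lemma sec_empty U (s t : sec U) : ~ (exists x, U x) -> s = t.
Proof.
move=> U0; apply: (@sec_sep _ _ U (fun=> False)); first split=> //.
  by move=> x Ux; case: U0; exists x.
by [].
Qed.

Lemma basic_open_open U (s : sec U) : open (basic_open s).
Proof.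
rewrite openE => x [Ux [b]].
have [V [Vx [t ->]]] := stalk_rep b.
have l : oI U V `<=` U by move=> ? [].
have r : oI U V `<=` V by move=> ? [].
have UVx : oI U V x by split.
rewrite -(germ_res Ux UVx l) -(germ_res Vx UVx r).
rewrite -[LHS]/(stalk_mul _ _) stalk_mulE -[RHS]/(stalk1 x) (stalk1E UVx).
move=> /germP[W [h [h' [Wx]]]]; rewrite rmorphM rmorph1 => e.
rewrite /interior nbhsE; exists (oset W).
  by split=> //; exact: opens_open.
move=> y Wy; exists (l _ (h _ Wy)); exists (germ Wy (res h (res r t))).
rewrite -(germ_res (l _ (h _ Wy)) Wy (subset_trans h l)) -(res_res l h).
by rewrite -[LHS]/(stalk_mul _ _) stalk_mulE e -stalk1E.
Qed.

Definition basic_opens U (s : sec U) : opens X := Opens (basic_open_open s).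

Lemma basic_opens_sub U (s : sec U) : basic_opens s `<=` U.
Proof. by move=> x []. Qed.

Lemma germD x U (Ux : U x) (s t : sec U) :
  germ Ux (s + t) = germ Ux s + germ Ux t.
Proof. by rewrite -stalk_addE. Qed.

Lemma germM x U (Ux : U x) (s t : sec U) :
  germ Ux (s * t) = germ Ux s * germ Ux t.
Proof. by rewrite -stalk_mulE. Qed.

Lemma germ0 x U (Ux : U x) : germ Ux 0 = 0.
Proof. by rewrite -stalk0E. Qed.

Lemma germN x U (Ux : U x) (s : sec U) : germ Ux (- s) = - germ Ux s.
Proof. by rewrite -stalk_oppE. Qed.

Lemma germ_scal x U (Ux : U x) c : germ Ux (scal U c) = stalk_const x c.
Proof.
rewrite /stalk_const -(@germ_res _ _ _ (oT X) _ I Ux (@subsetT _ _)).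
by rewrite res_scal.
Qed.

Lemma germ_sum x U (Ux : U x) n (s : 'I_n -> sec U) :
  germ Ux (\sum_i s i) = \sum_i germ Ux (s i).
Proof.
exact: (big_morph (germ Ux) (germD Ux) (germ0 Ux)).
Qed.

End Spaces.

Lemma invertible_mulI (A : comPzRingType) (a x y : A) :
  invertible a -> a * x = a * y -> x = y.
Proof.
move=> [b ab] e; have := congr1 ( *%R b) e.
by rewrite !mulrA [b * a]mulrC ab !mul1r.
Qed.

Lemma affine_basis (k : fieldType) (X : kspace k) (A V : opens X) (x : X) :
  affine A -> V `<=` A -> V x ->
  exists (T : opens X) (h : T `<=` A) (t : sec A),
    [/\ T x, T `<=` V & localization_at (res h) t].
Proof.
move=> [_ Abasis Aloc] VA Vx; have [t [tx tV]] := Abasis V x VA Vx.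
exists (basic_opens t), (@basic_opens_sub _ _ _ t), t; split=> //.
exact: Aloc.
Qed.

(** * Sections of an integral scheme *)

Section Integral.
Variables (k : fieldType) (X : scheme k) (X_integral : integral X).
Implicit Types U V W A : opens X.

Lemma sec_domain U x : U x -> domain (sec U).
Proof. by move=> Ux; apply: (X_integral.2 U); exists x. Qed.

Lemma sec_mulI U x (a s t : sec U) : U x -> a <> 0 -> a * s = a * t -> s = t.
Proof.
move=> Ux a0 e; have [_ dom] := sec_domain Ux.
have : a * (s - t) = 0 by rewrite mulrBr e subrr.
by case/dom=> // /subr0_eq.
Qed.

(** If [U] and [V] were disjoint, the section over their union that is [1] on
    [U] and [0] on [V] would be a nontrivial idempotent of a domain. *)
Lemma opens_meet U V x y : U x -> V y -> exists z, U z /\ V z.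
Proof.
move=> Ux Vy; apply: contrapT => UV0.
have disj W : W `<=` U -> W `<=` V -> forall s t : sec W, s = t.
  move=> WU WV s t; apply: sec_empty => -[z Wz]; apply: UV0.
  by exists z; split; [exact: WU|exact: WV].
pose UV : opens X := Opens (openU (opens_open U) (opens_open V)).
(* Covering by all open subsets of [U] or of [V] makes the gluing data a
   function of the open set alone. *)
pose C W := W `<=` U \/ W `<=` V.
have cov : covers C UV.
  split=> [W [WU|WV] z Wz|z [Uz|Vz]].
  - by left; apply: WU.
  - by right; apply: WV.
  - by exists U => //; left.
  - by exists V => //; right.
have [|s sP] := sec_glue cov (s := fun W => if `[< W `<=` U >] then 1 else 0).
  move=> W W' Z h h' CW CW'.
  case: asboolP => [WU|nWU]; case: asboolP => [WU'|nWU'];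
    rewrite ?rmorph1 ?rmorph0 //; apply: disj => z Zz.
  - exact/WU/h.
  - by case: CW' => // WV; exact/WV/h'.
  - exact/WU'/h'.
  - by case: CW => // WV; exact/WV/h.
have UUV : U `<=` UV by move=> z; left.
have VUV : V `<=` UV by move=> z; right.
have sU : res UUV s = 1.
  by rewrite sP; [rewrite asboolT|left].
have sV : res VUV s = 0.
  rewrite sP; last by right.
  by case: asboolP => // VU; apply: disj.
have [_ /(_ s (1 - s))] := sec_domain (UUV _ Ux).
case.
- apply: (sec_sep cov) => W h [WU|WV]; rewrite rmorph0.
    rewrite -(res_res UUV WU) rmorphM rmorphB rmorph1 sU subrr mulr0.
    by rewrite rmorph0.
  by rewrite -(res_res VUV WV) rmorphM sV mul0r rmorph0.
- move=> s0; have [n10 _] := sec_domain Ux; apply: n10.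
  by rewrite -sU s0 rmorph0.
- move=> s0; have [n10 _] := sec_domain Vy; apply: n10.
  have := congr1 (res VUV) s0.
  by rewrite rmorphB rmorph1 sV subr0 rmorph0.
Qed.

Lemma local_fraction A V x : affine A -> V `<=` A -> V x -> forall s : sec V,
  exists W (h : W `<=` V) (hA : W `<=` A) (c b : sec A),
    [/\ W x, invertible (res hA c) & res hA c * res h s = res hA b].
Proof.
move=> affA VA Vx s.
have [T [TA [t [Tx TV [inv _ frac]]]]] := affine_basis affA VA Vx.
have [n [b e]] := frac (res TV s).
exists T, TV, TA, (t ^+ n), b; split=> //; last by rewrite rmorphXn.
rewrite rmorphXn; have [u ut] := inv; exists (u ^+ n).
by rewrite -exprMn_comm ?ut ?expr1n //; exact: mulrC.
Qed.

(** The open set [V] contains the nonempty open set where some [t] does not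
    vanish; a section that vanishes there is killed by a power of [t]. *)
Lemma res_affine_inj A V x (h : V `<=` A) (a : sec A) :
  affine A -> V x -> res h a = 0 -> a = 0.
Proof.
move=> affA Vx a0.
have [T [TA [t [Tx TV [inv ker _]]]]] := affine_basis affA h Vx.
have [|n tn] := ker a; first by rewrite -(res_res h TV) a0 rmorph0.
have [_ dom] := sec_domain (h _ Vx).
have t0 : t <> 0.
  move=> t0; move: inv; rewrite t0 rmorph0 => -[u]; rewrite mul0r => e.
  by have [n10 _] := sec_domain Tx; apply: n10.
elim: n tn => [|n IH]; first by rewrite mul1r.
by rewrite exprS -mulrA => /dom[].
Qed.

(** Near a point of [U] a section is a fraction [b / c] of sections over an
    affine open set [A], with [c] invertible. The open set where this holds
    meets [V], because [X] is irreducible, and there [b] vanishes; so [b]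
    vanishes on [A], by the affine case. *)
Lemma res_inj U V x (h : V `<=` U) (s t : sec U) :
  V x -> res h s = res h t -> s = t.
Proof.
suff inj0 (a : sec U) : V x -> res h a = 0 -> a = 0.
  move=> Vx e; apply: subr0_eq; apply: inj0 => //.
  by rewrite rmorphB e subrr.
move=> Vx a0.
apply: (@sec_sep _ _ U (fun W => exists hW : W `<=` U, res hW a = 0)).
  split=> [W []//|y Uy].
  have [A Aaff Ay] := scheme_affine y.
  have UAy : oI U A y by split.
  have UA_U : oI U A `<=` U by move=> ? [].
  have UA_A : oI U A `<=` A by move=> ? [].
  have [W [hW [hA [c [b [Wy inv e]]]]]] :=
    local_fraction Aaff UA_A UAy (res UA_U a).
  exists W => //; exists (subset_trans hW UA_U).
  have [z [Wz Vz]] := opens_meet Wy Vx.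
  have l : oI W V `<=` W by move=> ? [].
  have r : oI W V `<=` V by move=> ? [].
  apply: (invertible_mulI inv); rewrite mulr0.
  move: e; rewrite (res_res _ _ (subset_trans hW UA_U)) => e; rewrite e.
  suff -> : b = 0 by rewrite rmorph0.
  apply: (@res_affine_inj A (oI W V) z (subset_trans l hA)) => //.
  rewrite -(res_res hA l) -e rmorphM.
  rewrite (res_res _ l (subset_trans r h)) -(res_res h r) a0 rmorph0.
  by rewrite mulr0.
by move=> W hW [hW' e]; rewrite (Prop_irrelevance hW hW') e rmorph0.
Qed.

Lemma germ_inj U x (Ux : U x) (s t : sec U) : germ Ux s = germ Ux t -> s = t.
Proof.
move=> /germP[W [h [h' [Wx e]]]]; apply: (res_inj (h := h) Wx).
by rewrite e (Prop_irrelevance h' h).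
Qed.

Lemma stalk_domain (x : X) : domain (stalk x).
Proof.
split=> [|a b].
  change ((1 : stalk x) = 0 -> False).
  rewrite -[LHS]/(stalk1 x) (stalk1E (U := oT X) I) -(germ0 (U := oT X) I).
  by move=> /germ_inj; have [] := @sec_domain (oT X) x I.
have [U [Ux [s [t [-> ->]]]]] := stalk_rep2 a b.
rewrite -germM -(germ0 Ux) => /germ_inj.
by have [_ dom] := sec_domain Ux; case/dom=> ->; [left|right].
Qed.

End Integral.

(** * Extending derivations by the quotient rule *)

(** The next three identities are the algebra of the quotient rule, with all
    denominators cleared: [s] and [t] are fractions with denominators [c] and
    [c'], the derivation takes the values [g] and [g'] on these denominators,
    and [u] and [v] at [s] and [t]. In the third, [c] and [c'] are denominators
    of the same [s]. *)
Lemma quotient_formula_add (R : comPzRingType) (c c' s t u v b b' g g' : R) :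
  c * u = b - s * g -> c' * v = b' - t * g' ->
  c * c' * (u + v) = c' * b + c * s * g' + (c * b' + c' * t * g)
                     - (s + t) * (c * g' + c' * g).
Proof.
move=> e e'; rewrite (_ : _ * _ = c' * (c * u) + c * (c' * v)); last by ring.
by rewrite e e'; ring.
Qed.

Lemma quotient_formula_mul (R : comPzRingType) (c c' s t u v b b' g g' : R) :
  c * u = b - s * g -> c' * v = b' - t * g' ->
  c * c' * (s * v + t * u) = c * s * b' + c' * t * b
                             - s * t * (c * g' + c' * g).
Proof.
move=> e e'.
rewrite (_ : _ * (_ + _) = c * s * (c' * v) + c' * t * (c * u)); last by ring.
by rewrite e e'; ring.
Qed.

Lemma quotient_formula_indep (R : comPzRingType)
    (c c' s u b b' db db' g g' : R) :
  c * s = b -> c' * s = b' -> c * u = db - s * g ->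
  c' * db + b * g' = c * db' + b' * g ->
  c * (c' * u) = c * (db' - s * g').
Proof.
move=> <- <- e e'; rewrite mulrCA e mulrBr mulrBr.
have -> : c' * db = c * db' + c' * s * g - c * s * g' by rewrite -e' addrK.
by ring.
Qed.

(** The fraction found near [x] represents [s] on all of [V], because
    restriction is injective. Its denominator may have zeros on [V]. *)
Lemma fraction (k : fieldType) (X : scheme k) (X_integral : integral X)
    (A V : opens X) x : affine A -> V `<=` A -> V x ->
  forall s : sec V, exists b c : sec A,
  c <> 0 /\ forall hA : V `<=` A, res hA c * s = res hA b.
Proof.
move=> A_affine VA Vx s.
have [W [h [hA [c [b [Wx inv e]]]]]] := local_fraction A_affine VA Vx s.
exists b, c; split.
  move=> c0; move: inv; rewrite c0 rmorph0 => -[u]; rewrite mul0r => e1.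
  by have [n10 _] := sec_domain X_integral Wx; apply: n10.
move=> hVA; apply: (res_inj X_integral (h := h) Wx); rewrite rmorphM.
by rewrite !(res_res _ _ hA).
Qed.

Section Extension.
Variables (k : fieldType) (X : scheme k) (X_integral : integral X).
Variables (A T : opens X) (A_affine : affine A) (TA : T `<=` A).
Variable d : sec A -> sec T.
Hypothesis dD : forall a b, d (a + b) = d a + d b.
Hypothesis dM : forall a b, d (a * b) = res TA a * d b + res TA b * d a.
Hypothesis d_scal : forall c, d (scal A c) = 0.
Implicit Types V W : opens X.

(** Quantifying over all fractions that represent [s], rather than choosing one,
    makes the relation stable under gluing. *)
Definition quotient_rule V (h : V `<=` T) (s u : sec V) : Prop :=
  forall (hA : V `<=` A) b c, res hA c * s = res hA b ->
    res hA c * u = res h (d b) - s * res h (d c).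

(** Two fractions that represent the same section satisfy a relation in [O(A)],
    to which [d] applies; so it is enough to check one of them. *)
Lemma quotient_ruleI V (h : V `<=` T) (hA : V `<=` A) (s u : sec V)
    (b c : sec A) :
  ((exists x, V x) -> c <> 0) -> res hA c * s = res hA b ->
  res hA c * u = res h (d b) - s * res h (d c) -> quotient_rule h s u.
Proof.
move=> c0 sE uE hA' b' c'; rewrite (Prop_irrelevance hA' hA) => sE'.
have [[x Vx]|V0] := pselect (exists x, V x); last exact: sec_empty.
have c0' : res hA c <> 0.
  rewrite -(rmorph0 (res hA)) => /(res_inj X_integral Vx).
  by apply: c0; exists x.
apply: (sec_mulI X_integral Vx c0').
apply: (quotient_formula_indep sE sE' uE).
have e : c' * b = c * b'.
  by apply: (res_inj X_integral (h := hA) Vx); rewrite !rmorphM -sE -sE' mulrCA.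
have := congr1 (res h \o d) e; rewrite /= !dM !rmorphD !rmorphM /=.
by rewrite !(res_res _ _ hA).
Qed.

Lemma quotient_rule_uniq V (h : V `<=` T) (s u v : sec V) :
  quotient_rule h s u -> quotient_rule h s v -> u = v.
Proof.
have [[x Vx]|V0] := pselect (exists x, V x); last by move=> *; exact: sec_empty.
have hA := subset_trans h TA.
have [b [c [c0 e]]] := fraction X_integral A_affine hA Vx s.
move=> uE vE; apply: (@sec_mulI _ _ X_integral V x (res hA c)) => //.
  by rewrite -(rmorph0 (res hA)) => /(res_inj X_integral Vx).
by rewrite (uE hA b c) ?(vE hA b c).
Qed.

Lemma quotient_rule_res V W (h : V `<=` T) (h' : W `<=` T) (g : W `<=` V) s u :
  quotient_rule h s u -> quotient_rule h' (res g s) (res g u).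
Proof.
have [[x Wx]|W0] := pselect (exists x, W x); last first.
  by move=> _ hA b c _; exact: sec_empty.
have hA := subset_trans h TA; have hA' := subset_trans g hA.
have [b [c [c0 /(_ hA) e]]] := fraction X_integral A_affine hA (g _ Wx) s.
move=> /(_ hA b c e) uE; apply: (@quotient_ruleI _ _ hA' _ _ b c) => //.
  by rewrite -!(res_res hA g) -rmorphM e.
by rewrite -(res_res hA g) -!(res_res h g) -!rmorphM -rmorphB uE.
Qed.

(** The value is unique, so it may be defined locally, where the denominator of
    a fraction can be taken invertible. *)
Lemma quotient_rule_ex V (h : V `<=` T) (s : sec V) :
  exists u, quotient_rule h s u.
Proof.
have hA := subset_trans h TA.
pose C W := exists g : W `<=` V, exists u,
  quotient_rule (subset_trans g h) (res g s) u.
have cov : covers C V.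
  split=> [W []//|x Vx].
  have [W [g [gA [c [b [Wx [i ci] e]]]]]] := local_fraction A_affine hA Vx s.
  exists W => //; exists g.
  exists (i * (res (subset_trans g h) (d b) -
               res g s * res (subset_trans g h) (d c))).
  apply: (@quotient_ruleI _ _ gA _ _ b c) => //; last by rewrite mulrA ci mul1r.
  move=> _ c0; move: ci; rewrite c0 rmorph0 mul0r => e1.
  by have [n10 _] := sec_domain X_integral Wx; apply: n10.
have loc W : {v : sec W | forall g : W `<=` V, C W ->
    quotient_rule (subset_trans g h) (res g s) v}.
  apply: cid; have [[g [u uP]]|no] := pselect (C W).
    by exists u => g'; rewrite (Prop_irrelevance g' g).
  by exists 0 => g /no.
have [|u uP] := sec_glue cov (s := fun W => sval (loc W)).
  move=> W W' Z g g' CW CW'.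
  have WV := cov.1 W CW; have WV' := cov.1 W' CW'.
  have ZT := subset_trans g (subset_trans WV h).
  apply: (quotient_rule_uniq (h := ZT) (s := res (subset_trans g WV) s)).
    rewrite -(res_res WV g); 
    exact: (@quotient_rule_res _ _ _ ZT g _ _ (svalP (loc W) WV CW)).
  rewrite -(res_res WV' g'); 
  exact: (@quotient_rule_res _ _ _ ZT g' _ _ (svalP (loc W') WV' CW')).
exists u => hA' b c e; apply: (sec_sep cov) => W g CW.
have := svalP (loc W) g CW (subset_trans g hA') b c.
rewrite rmorphM rmorphB rmorphM !(res_res _ _ (subset_trans g h)).
rewrite (res_res _ _ (subset_trans g hA')) uP //; apply.
by rewrite -!(res_res hA' g) -rmorphM e.
Qed.

Lemma derivation_extension :
  exists E : dersec T, forall (g : T `<=` T) a, dfun E g (res TA a) = d a.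
Proof.
pose E V (h : V `<=` T) s := sval (cid (quotient_rule_ex h s)).
have EP V (h : V `<=` T) s : quotient_rule h s (E V h s).
  exact: svalP (cid (quotient_rule_ex h s)).
have EE V (h : V `<=` T) s u : quotient_rule h s u -> E V h s = u.
  exact: quotient_rule_uniq (EP V h s).
have d1 : d 1 = 0.
  have := dM 1 1; rewrite mulr1 rmorph1 !mul1r => e.
  by apply: (addrI (d 1)); rewrite -e addr0.
have Eder V (h : V `<=` T) : derivation (scal V) (E V h).
  have hA := subset_trans h TA.
  have two s t : (exists x, V x) -> exists b c b' c' : sec A,
      [/\ c * c' <> 0, res hA c * s = res hA b & res hA c' * t = res hA b'].
    move=> [x Vx].
    have [b [c [c0 /(_ hA) e]]] := fraction X_integral A_affine hA Vx s.
    have [b' [c' [c0' /(_ hA) e']]] := fraction X_integral A_affine hA Vx t.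
    exists b, c, b', c'; split=> //.
    have [_ dom] := sec_domain X_integral (hA _ Vx).
    by case/dom.
  have dMr a b :
      res h (d (a * b)) = res hA a * res h (d b) + res hA b * res h (d a).
    by rewrite dM rmorphD !rmorphM !(res_res _ _ hA).
  split=> [s t|s t|c].
  - have [Vne|V0] := pselect (exists x, V x); last exact: sec_empty.
    have [b [c [b' [c' [cc' e e']]]]] := two s t Vne.
    apply: EE.
    apply: (@quotient_ruleI _ _ hA _ _ (c' * b + c * b') (c * c')) => //.
      rewrite rmorphD !rmorphM -e -e'; ring.
    rewrite dD rmorphD !dMr rmorphM -e -e'.
    rewrite (quotient_formula_add (EP V h s hA b c e) (EP V h t hA b' c' e')).
    ring.
  - have [Vne|V0] := pselect (exists x, V x); last exact: sec_empty.
    have [b [c [b' [c' [cc' e e']]]]] := two s t Vne.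
    apply: EE.
    apply: (@quotient_ruleI _ _ hA _ _ (b * b') (c * c')) => //.
      rewrite !rmorphM -e -e'; ring.
    rewrite !dMr rmorphM -e -e'.
    rewrite (quotient_formula_mul (EP V h s hA b c e) (EP V h t hA b' c' e')).
    by [].
  - apply: EE; have [[x Vx]|V0] := pselect (exists x, V x); last first.
      by move=> *; exact: sec_empty.
    apply: (@quotient_ruleI _ _ hA _ _ (scal A c) 1).
    + by move=> _; have [] := sec_domain X_integral (hA _ Vx).
    + by rewrite rmorph1 mul1r res_scal.
    + by rewrite d_scal d1 !rmorph0 !mulr0 subr0.
have Eres V W (h : V `<=` T) (h' : W `<=` T) (g : W `<=` V) s :
    res g (E V h s) = E W h' (res g s).
  by apply/esym/EE/quotient_rule_res.
exists (DerSec Eder Eres) => g a /=; apply: EE.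
have [[x Tx]|T0] := pselect (exists x, T x); last by move=> *; exact: sec_empty.
apply: (@quotient_ruleI _ _ TA _ _ a 1).
+ by move=> _; have [] := sec_domain X_integral (TA Tx).
+ by rewrite rmorph1 mul1r.
+ by rewrite d1 rmorph0 mulr0 subr0 rmorph1 mul1r res_id.
Qed.

End Extension.

(** * The stalk of the derivation sheaf *)

Definition stalk_action (k : fieldType) (X : kspace k) (U : opens X)
    (D : dersec U) (x : X) (d : stalk x -> stalk x) : Prop :=
  forall (V : opens X) (h : V `<=` U) (Vx : V x) s,
    d (germ Vx s) = germ Vx (dfun D h s).

Lemma stalk_action_derivation (k : fieldType) (X : kspace k) (U : opens X)
    (D : dersec U) (x : X) (Ux : U x) (d : stalk x -> stalk x) :
  stalk_action D d -> derivation (@stalk_const k X x) d.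
Proof.
move=> dE.
have rep a b : exists (V : opens X) (h : V `<=` U) (Vx : V x) (s t : sec V),
    a = germ Vx s /\ b = germ Vx t.
  have [V [Vx [s [t [-> ->]]]]] := stalk_rep2 a b.
  have l : oI U V `<=` U by move=> ? [].
  have r : oI U V `<=` V by move=> ? [].
  exists (oI U V), l, (conj Ux Vx), (res r s), (res r t).
  by rewrite !germ_res.
split=> [a b|a b|c].
- have [V [h [Vx [s [t [-> ->]]]]]] := rep a b.
  have [DD _ _] := dfunP D h.
  by rewrite -germD !(dE _ h) DD germD.
- have [V [h [Vx [s [t [-> ->]]]]]] := rep a b.
  by rewrite -germM !(dE _ h); have [_ -> _] := dfunP D h; rewrite germD !germM.
- rewrite -(germ_scal Ux) (dE _ (@subset_refl _ _)).
  by have [_ _ ->] := dfunP D (@subset_refl _ U); rewrite germ0.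
Qed.

Lemma stalk_action_ex (k : fieldType) (X : kspace k) (U : opens X)
    (D : dersec U) (x : X) : U x ->
  exists d : stalk x -> stalk x, stalk_action D d.
Proof.
move=> Ux; suff loc (a : stalk x) : {b : stalk x | forall (V : opens X)
    (h : V `<=` U) (Vx : V x) s, a = germ Vx s -> b = germ Vx (dfun D h s)}.
  exists (fun a => sval (loc a)) => V h Vx s.
  exact: (svalP (loc (germ Vx s))).
apply: cid; have [V [Vx [s ->]]] := stalk_rep a.
have l : oI U V `<=` U by move=> ? [].
have r : oI U V `<=` V by move=> ? [].
exists (@germ _ _ x (oI U V) (conj Ux Vx) (dfun D l (res r s))).
move=> V' h Vx' s' /germP[W [g [g' [Wx e]]]].
have W_UV : W `<=` oI U V by move=> y Wy; split; [exact/h/g'|exact: (g y Wy)].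
apply/germP; exists W, W_UV, g'; split=> //.
rewrite (dfun_res D _ (subset_trans g' h)) (dfun_res D _ (subset_trans g' h)).
by rewrite -e (res_res r W_UV g).
Qed.

Lemma common_representatives (k : fieldType) (X : kspace k) (W : opens X)
    (x : X) (Wx : W x) n (a : 'I_n -> stalk x) :
  exists (Z : opens X) (ZW : Z `<=` W) (Zx : Z x) (s : 'I_n -> sec Z),
    forall i, a i = germ Zx (s i).
Proof.
have [Z [ZW [Zx H]]] : exists (Z : opens X) (ZW : Z `<=` W) (Zx : Z x),
    forall i, exists s : sec Z, a i = germ Zx s.
  suff /(_ (enum 'I_n)) [Z [ZW [Zx H]]] : forall l : seq 'I_n,
      exists (Z : opens X) (ZW : Z `<=` W) (Zx : Z x),
      forall i, i \in l -> exists s : sec Z, a i = germ Zx s.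
    by exists Z, ZW, Zx => i; apply: H; rewrite mem_enum.
  elim=> [|j l [Z [ZW [Zx IH]]]]; first by exists W, (@subset_refl _ _), Wx.
  have [Y [Yx [s sE]]] := stalk_rep (a j).
  have YZ_Y : oI Y Z `<=` Y by move=> ? [].
  have YZ_Z : oI Y Z `<=` Z by move=> ? [].
  exists (oI Y Z), (subset_trans YZ_Z ZW), (conj Yx Zx) => i.
  rewrite inE => /orP[/eqP ->|/IH[t ->]].
    by exists (res YZ_Y s); rewrite germ_res.
  by exists (res YZ_Z t); rewrite germ_res.
exists Z, ZW, Zx, (fun i => sval (cid (H i))) => i.
exact: (svalP (cid (H i))).
Qed.

Section Germs.
Variables (k : fieldType) (X : scheme k) (X_integral : integral X).
Implicit Types U V W A : opens X.

(** The germ at [x] says nothing directly about sections over open sets that do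
    not contain [x]. On an affine neighbourhood [A] of [x] the derivation kills
    the sections over [A], as they embed into the stalk, hence also their
    fractions; and every nonempty open set meets [A]. *)
Lemma dersec_germ_eq0 U x (Ux : U x) (D : dersec U) :
  stalk_action D (fun=> 0 : stalk x) -> D = 0.
Proof.
move=> D0; apply: dersecP => V h s /=.
have [[y Vy]|V0] := pselect (exists y, V y); last exact: sec_empty.
have [A affA Ax] := scheme_affine x.
have [z [Vz [Uz Az]]] := opens_meet X_integral (V := oI U A) Vy (conj Ux Ax).
have UA_U : oI U A `<=` U by move=> ? [].
have UA_A : oI U A `<=` A by move=> ? [].
have D0A a : dfun D UA_U (res UA_A a) = 0.
  have UAx : oI U A x by split.
  by apply: (germ_inj X_integral (Ux := UAx)); rewrite -D0 germ0.
have Wz : oI V A z by split.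
have W_V : oI V A `<=` V by move=> ? [].
have W_A : oI V A `<=` A by move=> ? [].
have W_U := subset_trans W_V h.
have W_UA : oI V A `<=` oI U A by move=> ? [] /h.
apply: (res_inj X_integral (h := W_V) Wz); rewrite rmorph0 (dfun_res D h W_U).
have [b [c [c0 /(_ W_A) e]]] := fraction X_integral affA W_A Wz (res W_V s).
have c0' : res W_A c <> 0.
  by rewrite -(rmorph0 (res W_A)) => /(res_inj X_integral Wz).
apply: (sec_mulI X_integral Wz c0'); rewrite mulr0.
have D0W a : dfun D W_U (res W_A a) = 0.
  by rewrite -(res_res UA_A W_UA) -(dfun_res D UA_U) D0A rmorph0.
have [_ DM _] := dfunP D W_U.
by have := D0W b; rewrite -e DM D0W mulr0 addr0.
Qed.

(** The values of [d] on generators of the ring of an affine neighbourhood have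
    representatives on a common open set [W], and then so does the value on
    every element of that ring. These representatives are unique, as sections over [W]
    embed into the stalk, so the laws of a derivation carry over from [d]. *)
Lemma stalk_derivation_extends (x : X) (d : stalk x -> stalk x) :
  finite_type_over_k X -> derivation (@stalk_const k X x) d ->
  exists (U : opens X) (D : dersec U), U x /\ stalk_action D d.
Proof.
move=> [n [V [Vcov Vaff]]] [dD dM d_scal].
have [i Ax] := Vcov x; have [affA [m [g gP]]] := Vaff i.
move: (V i) Ax affA g gP => A Ax affA g gP {V Vcov Vaff n i}.
(* representatives near x of the values of d on the generators *)
have [W [WA [Wx [g' g'E]]]] :=
  common_representatives Ax (fun j => d (germ Ax (g j))).
have dA : forall a : sec A, {s : sec W | d (germ Ax a) = germ Wx s}.
  move=> a; apply: cid; move: a.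
  apply: gP => [c|j|a b [s e] [t e']|a b [s e] [t e']].
  - by exists 0; rewrite germ_scal d_scal germ0.
  - by exists (g' j).
  - by exists (s + t); rewrite !germD dD e e'.
  - exists (res WA a * t + res WA b * s).
    by rewrite germD !germM !(germ_res Ax) dM e e'.
pose dl a := sval (dA a).
have dlE a : germ Wx (dl a) = d (germ Ax a) by rewrite -(svalP (dA a)).
have [|||E EE] := @derivation_extension k X X_integral A W affA WA dl.
- move=> a b; apply: (germ_inj X_integral (Ux := Wx)).
  by rewrite germD !dlE germD dD.
- move=> a b; apply: (germ_inj X_integral (Ux := Wx)).
  by rewrite germD !germM !dlE germM dM !(germ_res Ax).
- move=> c; apply: (germ_inj X_integral (Ux := Wx)).
  by rewrite dlE germ_scal d_scal germ0.
(* [E] and [d] agree on sections over [A], hence on their fractions. *)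
exists W, E; split=> // V h Vx s.
have VA := subset_trans h WA.
have [b [c [c0 /(_ VA) e]]] := fraction X_integral affA VA Vx s.
have [_ dom] := stalk_domain X_integral x.
have : germ Ax c * (d (germ Vx s) - germ Vx (dfun E h s)) = 0.
  have [_ EM _] := dfunP E h.
  have EV a : germ Vx (dfun E h (res VA a)) = d (germ Ax a).
    rewrite -(res_res WA h) -(dfun_res E (@subset_refl _ _)) EE.
    by rewrite germ_res dlE.
  have e1 := EV b; rewrite -e EM germD !germM EV in e1.
  have e2 : germ Ax b = germ Ax c * germ Vx s.
    by rewrite -(germ_res Ax Vx VA) -e germM germ_res.
  move: e1; rewrite e2 dM germ_res => /addIr e1.
  by rewrite mulrBr e1 subrr.
case/dom=> [|/subr0_eq //].
by rewrite -(germ0 Ax) => /germ_inj - /(_ X_integral) /c0.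
Qed.

Lemma Der_torsion_eq0 U (D : Der X U) : torsion D -> D = 0.
Proof.
move=> tD.
pose C W := W `<=` U /\ exists2 a : sec W, a <> 0 &
  forall h : W `<=` U, a *: mres (Der X) h D = 0.
apply: (@msec_sep _ _ (Der X) U C).
  split=> [W []//|x Ux].
  have [W [h [a [Wx a0 e]]]] := tD x Ux.
  exists W => //; split=> //; exists a => // h'.
  by rewrite (Prop_irrelevance h' h).
move=> W h [_ [a a0 /(_ h) aD]]; rewrite raddf0; apply: dersecP => V g s.
have [[x Vx]|V0] := pselect (exists y, V y); last exact: sec_empty.
have /(congr1 (fun F : dersec W => dfun F g s)) /= e := aD.
apply: (sec_mulI X_integral (a := res g a) Vx).
  by rewrite -(rmorph0 (res g)) => /(res_inj X_integral Vx).
by rewrite mulr0; exact: e.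
Qed.

Lemma dfun_sum U V (h : V `<=` U) r (F : 'I_r -> dersec U) s :
  dfun (\sum_i F i) h s = \sum_i dfun (F i) h s.
Proof. exact: (big_morph (fun F : dersec U => dfun F h s)). Qed.

(** Both halves of the basis property are lifted from the stalk to a
    neighbourhood: a derivation extends, and a relation between derivations of
    the stalk is a relation between their extensions. *)
Lemma der_free_stalk r (x : X) : finite_type_over_k X ->
  mod_torsion_locally_free (Der X) r -> der_free (@stalk_const k X x).
Proof.
move=> ftX /(_ x)[V [e [Vx span indep]]].
pose d i : stalk x -> stalk x := sval (cid (stalk_action_ex (e i) Vx)).
have dE i : stalk_action (e i) (d i) := svalP (cid (stalk_action_ex (e i) Vx)).
exists r, d; split=> [i|D Dder]; first exact: stalk_action_derivation (dE i).
have [U [E [Ux EE]]] := stalk_derivation_extends ftX Dder.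
have UV_U : oI U V `<=` U by move=> ? [].
have UV_V : oI U V `<=` V by move=> ? [].
have [W [WUV [WV [c [Wx /Der_torsion_eq0/subr0_eq cE]]]]] :=
  span (oI U V) UV_V (dres UV_U E) x (conj Ux Vx).
exists [ffun i => germ Wx (c i)]; split.
  move=> a; have [Z [Zx [s ->]]] := stalk_rep a.
  have ZW_Z : oI Z W `<=` Z by move=> ? [].
  have ZW_W : oI Z W `<=` W by move=> ? [].
  have ZWx : oI Z W x by [].
  have := congr1 (fun F : dersec W => dfun F ZW_W (res ZW_Z s)) cE.
  rewrite dfun_sum /= => /(congr1 (germ ZWx)).
  rewrite -EE germ_sum germ_res => ->.
  apply: eq_bigr => i _; rewrite ffunE germM germ_res -(dE i).
  by rewrite germ_res.
move=> c' c'E.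
(* common representatives of the coefficients c' *)
have [Z [ZW [Zx [b bE]]]] := common_representatives Wx c'.
apply/ffunP => i; rewrite ffunE bE -(germ_res Wx Zx ZW); congr germ.
have ZV := subset_trans ZW WV.
have ZU : Z `<=` U by move=> y /ZW/WUV[].
apply/subr0_eq; apply: (indep Z ZV (fun i => res ZW (c i) - b i)).
suff -> : \sum_i (res ZW (c i) - b i) *: mres (Der X) ZV (e i) = 0.
  by move=> y Zy; exists Z, (@subset_refl _ _), 1; split=> //;
    [have [] := sec_domain X_integral Zy|rewrite raddf0 scaler0].
have e0 : dres ZU E = \sum_i b i *: dres ZV (e i).
  apply: subr0_eq; apply: (dersec_germ_eq0 Zx) => Y h Yx s.
  rewrite /= germD germN dfun_sum germ_sum -EE c'E.
  apply/esym/eqP; rewrite subr_eq0; apply/eqP/eq_bigr => j _.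
  by rewrite /= germM germ_res bE -(dE j).
have e1 : dres ZU E = \sum_i res ZW (c i) *: dres ZV (e i).
  have := congr1 (mres (Der X) ZW) cE.
  rewrite raddf_sum !(mres_mres _ _ (subset_trans ZW WUV)).
  rewrite [LHS](dres_dres _ _ ZU) => ->; apply: eq_bigr => j _.
  by rewrite mresZ (mres_mres _ _ ZV).
transitivity (dres ZU E - dres ZU E); last exact: subrr.
rewrite {1}e1 e0 -sumrB; apply: eq_bigr => j _.
by rewrite scalerBl.
Qed.

End Germs.

(** * Transport along an isomorphism *)

Section Pushforward.
Variables (k : fieldType) (X Y : kspace k) (g : morphism X Y) (M : omod X).
Implicit Types U V W : opens Y.

Definition direct_sec U : Type := M (preim g U).
HB.instance Definition _ U := GRing.Zmodule.on (direct_sec U).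

Definition direct_scale U (a : sec U) (m : direct_sec U) : direct_sec U :=
  comap g (@subset_refl _ (preim g U)) a *: (m : M (preim g U)).

Fact direct_scaleA U (a b : sec U) (m : direct_sec U) :
  direct_scale a (direct_scale b m) = direct_scale (a * b) m.
Proof. by rewrite /direct_scale scalerA rmorphM. Qed.
Fact direct_scale1 U : left_id 1 (@direct_scale U).
Proof. by move=> m; rewrite /direct_scale rmorph1 scale1r. Qed.
Fact direct_scaleDr U : right_distributive (@direct_scale U) +%R.
Proof. by move=> a m n; rewrite /direct_scale scalerDr. Qed.
Fact direct_scaleDl U (m : direct_sec U) :
  {morph (@direct_scale U)^~ m : a b / a + b}.
Proof. by move=> a b; rewrite /direct_scale rmorphD scalerDl. Qed.

HB.instance Definition _ U := GRing.Zmodule_isLmodule.Build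
  (sec U) (direct_sec U)
  (@direct_scaleA U) (@direct_scale1 U) (@direct_scaleDr U) (@direct_scaleDl U).

Fact preim_sub U V (h : V `<=` U) : preim g V `<=` preim g U.
Proof. by move=> x /h. Qed.

Definition direct_res U V (h : V `<=` U) :
    {additive direct_sec U -> direct_sec V} :=
  mres M (preim_sub h).

Fact direct_resZ U V (h : V `<=` U) a m :
  direct_res h (a *: m) = res h a *: direct_res h m.
Proof.
rewrite /direct_res -[a *: m]/(comap g _ a *: (m : M _)) mresZ.
by rewrite (@comap_res _ _ _ g _ _ _ _ _ (@subset_refl _ (preim g V)) h).
Qed.

Fact direct_res_id U (h : U `<=` U) m : direct_res h m = m.
Proof. exact: mres_id. Qed.

Fact direct_res_res U V W (h : V `<=` U) (h' : W `<=` V) (h'' : W `<=` U) m :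
  direct_res h' (direct_res h m) = direct_res h'' m.
Proof. exact: mres_mres. Qed.

Let inverse_images (C : opens Y -> Prop) (V : opens X) : Prop :=
  exists2 W, C W & oset V = oset (preim g W).

Fact preim_covers C U : covers C U -> covers (inverse_images C) (preim g U).
Proof.
move=> [CU UC]; split=> [V [W CW ->]|x /UC[W CW Wx]].
  exact: preim_sub (CU W CW).
by exists (preim g W) => //; exists W.
Qed.

Fact direct_sec_sep U C : covers C U -> forall m n : direct_sec U,
  (forall V (h : V `<=` U), C V -> direct_res h m = direct_res h n) -> m = n.
Proof.
move=> cov m n mn; apply: (msec_sep (preim_covers cov)) => V h [W CW e].
have VW : V `<=` preim g W by rewrite e.
have := congr1 (mres M VW) (mn W (cov.1 _ CW) CW).
by rewrite !(mres_mres _ _ h).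
Qed.

Fact direct_sec_glue U C : covers C U -> forall m : (forall V, direct_sec V),
  (forall V V' W (h : W `<=` V) (h' : W `<=` V'), C V -> C V' ->
     direct_res h (m V) = direct_res h' (m V')) ->
  exists t : direct_sec U, forall V (h : V `<=` U), C V -> direct_res h t = m V.
Proof.
move=> cov m mcompat.
(* Gluing data indexed by open sets of [Y] become gluing data on [X] only if
   the choice of an open set of [Y] above a given one does not matter. *)
have agree V V' (Z : opens X) (h : Z `<=` preim g V) (h' : Z `<=` preim g V') :
    C V -> C V' -> mres M h (m V) = mres M h' (m V').
  move=> CV CV'.
  have l : oI V V' `<=` V by move=> x [].
  have r : oI V V' `<=` V' by move=> x [].
  have i : Z `<=` preim g (oI V V').
    by move=> x Zx; split; [exact: (h x Zx)|exact: (h' x Zx)].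
  have := congr1 (mres M i) (mcompat V V' (oI V V') l r CV CV').
  by rewrite /direct_res (mres_mres _ _ h) (mres_mres _ _ h').
have loc (Z : opens X) : {v : M Z | forall V (h : Z `<=` preim g V),
    C V -> v = mres M h (m V)}.
  apply: cid.
  have [[V [CV h]]|no] := pselect (exists V, C V /\ Z `<=` preim g V).
    by exists (mres M h (m V)) => V' h' CV'; exact: agree.
  by exists 0 => V h CV; case: no; exists V.
have [|t tP] := msec_glue (preim_covers cov) (m := fun Z => sval (loc Z)).
  move=> Z1 Z2 Z3 h1 h2 [V1 CV1 e1] [V2 CV2 e2].
  have i1 : Z1 `<=` preim g V1 by rewrite e1.
  have i2 : Z2 `<=` preim g V2 by rewrite e2.
  rewrite (svalP (loc Z1) V1 i1 CV1) (svalP (loc Z2) V2 i2 CV2).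
  rewrite (mres_mres _ _ (subset_trans h1 i1)).
  rewrite (mres_mres _ _ (subset_trans h2 i2)).
  exact: agree.
exists t => V h CV.
have /= -> := tP (preim g V) (preim_sub h); last by exists V.
by rewrite (svalP (loc _) V (@subset_refl _ _) CV) mres_id.
Qed.

Definition pushforward : omod Y :=
  @OMod k Y (fun U => direct_sec U) direct_res direct_resZ direct_res_id
    direct_res_res direct_sec_sep direct_sec_glue.

End Pushforward.

Section HomCategory.
Variables (k : fieldType) (X : kspace k).
Implicit Types M N P : omod X.

Definition mhom_id M : mhom M M :=
  @MHom k X M M (fun U => idfun : {linear M U -> M U}) (fun U V h m => erefl).

Fact mhom_comp_res M N P (w' : mhom N P) (w : mhom M N) (U V : opens X)
  (h : V `<=` U) m : mres P h ((w' U \o w U) m) = (w' V \o w V) (mres M h m).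
Proof. by rewrite /= !hfun_res. Qed.

Definition mhom_comp M N P (w' : mhom N P) (w : mhom M N) : mhom M P :=
  @MHom k X M P (fun U => w' U \o w U : {linear M U -> P U})
    (mhom_comp_res w' w).

End HomCategory.

(** One half of [f] and [g] being mutually inverse. The condition on sections is
    stated for arbitrary open sets, so that it applies without identifying an
    open set with its image under inverse images along [f] and [g]. *)
Definition inverse_morphisms (k : fieldType) (X Y : kspace k)
    (f : morphism Y X) (g : morphism X Y) : Prop :=
  (forall y, g (f y) = y) /\ forall (U U' : opens Y) (V : opens X)
    (h : V `<=` g @^-1` U) (h' : U' `<=` f @^-1` V) (i : U' `<=` U) s,
    comap f h' (comap g h s) = res i s.

Lemma inverse_of_comp (k : fieldType) (X Y : kspace k)
    (f : morphism Y X) (g : morphism X Y) :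
  morphism_eq (mcomp g f) (mid Y) -> inverse_morphisms f g.
Proof.
move=> [gf gfE]; split=> // U U' V h h' i s.
have j : U' `<=` (mcomp g f) @^-1` U by move=> y /i Uy; move: (gf y) => /= ->.
rewrite -[RHS](gfE U U' j i s) /=.
have -> : comap g h s =
    res (h : V `<=` preim g U) (comap g (@subset_refl _ (preim g U)) s).
  rewrite (@comap_res _ _ _ g U U (preim g U) V _ h (@subset_refl _ _) h).
  by rewrite res_id.
rewrite -(@comap_res _ _ _ f (preim g U) V U' U' j h' h (@subset_refl _ _)).
by rewrite res_id.
Qed.

(** The direct image of [M] along the inverse [g] is another pullback of [M]
    along [f]. The universal property of [N] compares the two: it gives [w] from
    [N] to the direct image, and [w2] in the other direction is [u] read over
    inverse images along [g]. Since [w] and [u] preserve torsion, [w] maps local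
    sections that form a basis of [N] modulo torsion to such sections of [M]. *)
Lemma mod_torsion_locally_free_descends (k : fieldType) (X Y : kspace k)
    (f : morphism Y X) (g : morphism X Y) (M : omod X) (N : omod Y)
    (u : cohom f M N) r :
  inverse_morphisms f g -> inverse_morphisms g f -> is_pullback u ->
  mod_torsion_locally_free N r -> mod_torsion_locally_free M r.
Proof.
move=> [gf gfE] [fg fgE] univ.
pose P := pushforward g M.
have sub_pre (U : opens X) (V : opens Y) : V `<=` f @^-1` U -> preim g V `<=` U.
  by move=> h x /h; rewrite /preimage /= fg.
have [v vE] : exists v : cohom f M P, forall (U : opens X) (V : opens Y)
    (h : V `<=` f @^-1` U) (i : preim g V `<=` U) m,
    v U V h m = mres M i m :> M (preim g V).
  pose vf (U : opens X) (V : opens Y) (h : V `<=` f @^-1` U) :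
      {additive M U -> P V} :=
    mres M (sub_pre U V h).
  have vZ U V h a m : vf U V h (a *: m) = comap f h a *: vf U V h m.
    rewrite -[RHS]/(comap g _ _ *: (_ : M _)) (fgE _ _ _ _ _ (sub_pre U V h)).
    by rewrite /vf mresZ.
  have vR (U U' : opens X) (V V' : opens Y) (h : V `<=` f @^-1` U)
      (h' : V' `<=` f @^-1` U') (i : U' `<=` U) (j : V' `<=` V) m :
      mres P j (vf U V h m) = vf U' V' h' (mres M i m).
    rewrite [LHS](mres_mres _ _ (subset_trans (sub_pre _ _ h') i)).
    by rewrite [RHS](mres_mres _ _ (subset_trans (sub_pre _ _ h') i)).
  exists (CoHom vZ vR) => U V h i m /=; congr (mres M _ m).
  exact: Prop_irrelevance.
have [w [wE _]] := univ P v.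
have [w2 w2E] : exists w2 : mhom P N, forall V (m : P V)
    (h : V `<=` f @^-1` (preim g V)), w2 V m = u (preim g V) V h m.
  have pre (V : opens Y) : V `<=` f @^-1` (preim g V).
    by move=> y; rewrite /preimage /= gf.
  pose wf V (m : P V) : N V := u (preim g V) V (pre V) m.
  have wL V : linear (@wf V).
    move=> a m n; rewrite /wf raddfD /=; congr (_ + _).
    rewrite -[a *: m]/(comap g _ a *: (m : M _)) cfunZ.
    by rewrite (gfE _ _ _ _ _ (@subset_refl _ _)) res_id.
  pose wl V : {linear P V -> N V} := HB.pack (@wf V)
    (GRing.isLinear.Build _ _ _ _ (@wf V) (wL V)).
  have wR (U V : opens Y) (h : V `<=` U) m :
      mres N h (wl U m) = wl V (mres P h m).
    exact: cfun_res.
  exists (MHom wR) => V m h /=; rewrite /wf; congr (u _ _ _ _).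
  exact: Prop_irrelevance.
(* both sides are endomorphisms of [N] compatible with [u] *)
have w2w V n : w2 V (w V n) = n.
  have [w0 [_ w0E]] := univ N u.
  transitivity (w0 V n); last by apply/esym/(w0E (mhom_id N)).
  apply: (w0E (mhom_comp w2 w)) => U W h m /=.
  have j : W `<=` f @^-1` (preim g W) by move=> y; rewrite /preimage /= gf.
  rewrite wE (vE _ _ _ (sub_pre _ _ h)) (w2E _ _ j).
  by rewrite -(cfun_res u h j (sub_pre _ _ h) (@subset_refl _ _)) mres_id.
have wtor (V : opens Y) (n : N V) :
    torsion n -> torsion (w V n : M (preim g V)).
  move=> nt x /nt[W [h [a [Wx a0 e]]]].
  exists (preim g W), (preim_sub h), (comap g (@subset_refl _ (preim g W)) a).
  split=> //.
    have j : W `<=` f @^-1` (preim g W) by move=> y; rewrite /preimage /= gf.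
    move=> /(congr1 (comap f j)).
    by rewrite (gfE _ _ _ _ _ (@subset_refl _ W)) res_id rmorph0.
  have := congr1 (w W) e; rewrite linearZ raddf0 -hfun_res.
  exact.
have utor (W : opens X) (m : M W) :
    torsion m -> torsion (u W (preim f W) (@subset_refl _ _) m).
  move=> mt y /mt[Z [ZW [a [Zy a0 e]]]].
  exists (preim f Z), (preim_sub ZW), (comap f (@subset_refl _ (preim f Z)) a).
  split=> //.
    have j : Z `<=` g @^-1` (preim f Z) by move=> x; rewrite /preimage /= fg.
    move=> /(congr1 (comap g j)).
    by rewrite (fgE _ _ _ _ _ (@subset_refl _ Z)) res_id rmorph0.
  by rewrite (cfun_res u _ (@subset_refl _ (preim f Z)) ZW) -cfunZ e raddf0.
move=> Nfree x; have [V [e [Vgx span indep]]] := Nfree (g x).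
exists (preim g V), (fun i => w V (e i)); split=> // [W WV m y Wy|W WV c].
- have fWV : preim f W `<=` V by move=> z /WV; rewrite /= /preimage /= gf.
  have fWgy : preim f W (g y) by rewrite /omem /= /preimage /= fg.
  have [Z [ZW [ZV [c [Zgy tor]]]]] :=
    span _ fWV (u W (preim f W) (@subset_refl _ _) m) (g y) fWgy.
  have gZW : preim g Z `<=` W by exact: sub_pre ZW.
  exists (preim g Z), gZW, (preim_sub ZV),
    (fun i => comap g (@subset_refl _ (preim g Z)) (c i)); split=> //.
  have wm : w Z (mres N ZW (u W (preim f W) (@subset_refl _ _) m)) =
      mres M gZW m.
    rewrite -hfun_res wE (vE _ _ _ (sub_pre _ _ (@subset_refl _ (preim f W)))).
    exact: (mres_mres _ _ gZW).
  have wc i : w Z (c i *: mres N ZV (e i)) =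
      comap g (@subset_refl _ (preim g Z)) (c i) *:
      mres M (preim_sub ZV) (w V (e i)).
    by rewrite linearZ -hfun_res.
  have := wtor _ _ tor; rewrite linearB linear_sum /= wm.
  by rewrite (eq_bigr _ (fun i _ => wc i)).
- move=> tor.
  have fWV : preim f W `<=` V by move=> z /WV; rewrite /= /preimage /= gf.
  have ue i :
      u W (preim f W) (@subset_refl _ _) (c i *: mres M WV (w V (e i))) =
      comap f (@subset_refl _ (preim f W)) (c i) *: mres N fWV (e i).
    have j : V `<=` f @^-1` (preim g V) by move=> y; rewrite /preimage /= gf.
    by rewrite cfunZ -(cfun_res u j _ WV fWV) -w2E w2w.
  have := utor _ _ tor; rewrite raddf_sum (eq_bigr _ (fun i _ => ue i)).
  move=> /(indep _ fWV
    (fun i => comap f (@subset_refl _ (preim f W)) (c i))) c0 i.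
  have j : W `<=` g @^-1` (preim f W) by move=> y; rewrite /preimage /= fg.
  rewrite -[c i](res_id (@subset_refl _ W)).
  by rewrite -(fgE _ _ _ (@subset_refl _ (preim f W)) j) c0 rmorph0.
Qed.

(** * The theorem *)

Theorem theorem2p1 (k : fieldType) (k_perfect : perfect_field k)
  (X : scheme k) (X_variety : integral_variety X)
  (B : scheme k) (f : morphism B X) (f_blowup : is_blowup (Der X) f)
  (ZL : zariski_lipman k) :
  isomorphism f -> nonsingular X.
Proof.
move=> [g [gf fg]] x; apply: (ZL X X_variety).
have [X_integral _ X_ft] := X_variety.
have [_ _ _ [r [_ [N [u [u_univ N_free]]] _]]] := f_blowup.
apply: (@der_free_stalk _ _ X_integral r) => //.
have f_inv := inverse_of_comp gf; have g_inv := inverse_of_comp fg.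
exact: mod_torsion_locally_free_descends f_inv g_inv u_univ N_free.
Qed.
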